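(* Let $\mathcal{U}$ be a Hilbert space, let $\mathbb{J}\subset\mathbb{Z}$, and for each $j\in\mathbb{J}$ let $\mathcal{V}_j$ be a Hilbert space with an orthonormal basis $\{e_{j,k}: k\in\mathbb{K}_j\}$, where $\mathbb{K}_j\subset\mathbb{Z}$. Let $\Lambda_j\in\mathcal{L}(\mathcal{U},\mathcal{V}_j)$ for $j\in\mathbb{J}$, and put $u_{j,k}=\Lambda_j^* e_{j,k}\in\mathcal{U}$ for $j\in\mathbb{J}$, $k\in\mathbb{K}_j$ (the sequence induced by $\{\Lambda_j\}$ with respect to $\{e_{j,k}\}$). Then: (1) $\{\Lambda_j: j\in\mathbb{J}\}$ is a g-frame (resp. g-Bessel sequence, tight g-frame, g-Riesz basis, g-orthonormal basis) for $\mathcal{U}$ with respect to $\{\mathcal{V}_j: j\in\mathbb{J}\}$ if and only if $\{u_{j,k}: j\in\mathbb{J},k\in\mathbb{K}_j\}$ is a frame (resp. Bessel sequence, tight frame, Riesz basis, orthonormal basis) for $\mathcal{U}$. (2) If $\{\Lambda_j: j\in\mathbb{J}\}$ is a g-frame for $\mathcal{U}$ with respect to $\{\mathcal{V}_j: j\in\mathbb{J}\}$, then $$\sum_{j\in\mathbb{J}}\dim\mathcal{V}_j\ \ge\ \dim\mathcal{U},$$ and equality holds whenever $\{\Lambda_j: j\in\mathbb{J}\}$ is a g-Riesz basis. (3) If $\{\Lambda_j: j\in\mathbb{J}\}$ is a g-frame, then the g-frame operator of $\{\Lambda_j: j\in\mathbb{J}\}$ coincides with the frame operator of $\{u_{j,k}: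 j\in\mathbb{J},k\in\mathbb{K}_j\}$. (4) Let $\tilde\Lambda_j\in\mathcal{L}(\mathcal{U},\mathcal{V}_j)$, $j\in\mathbb{J}$, and let $\tilde u_{j,k}=\tilde\Lambda_j^*e_{j,k}$ be the sequence induced by $\{\tilde\Lambda_j\}$ with respect to $\{e_{j,k}\}$. Then $\{\Lambda_j: j\in\mathbb{J}\}$ and $\{\tilde\Lambda_j: j\in\mathbb{J}\}$ are a pair of dual g-frames (resp. canonical dual g-frames) if and only if the induced sequences $\{u_{j,k}\}$ and $\{\tilde u_{j,k}\}$ are a pair of dual frames (resp. canonical dual frames) for $\mathcal{U}$.
   Context: $\mathcal{L}(\mathcal{U},\mathcal{V}_j)$ is the space of bounded linear operators from $\mathcal{U}$ to $\mathcal{V}_j$; inner products are linear in the first argument; $\dim$ is Hilbert space dimension. Let $\Lambda_j\in\mathcal{L}(\mathcal{U},\mathcal{V}_j)$, $j\in\mathbb{J}$. - $\{\Lambda_j\}$ is a g-frame for $\mathcal{U}$ with respect to $\{\mathcal{V}_j\}$ if there are constants $A,B>0$ with $A\|f\|^2\le\sum_{j\in\mathbb{J}}\|\Lambda_jf\|^2\le B\|f\|^2$ for all $f\in\mathcal{U}$. It is a tight g-frame if one can take $A=B$. It is a g-Bessel sequence if the right-hand inequality holds for some $B>0$. - $\{\Lambda_j\}$ is g-complete if $\{f\in\mathcal{U}:\Lambda_jf=0 \text{ for all } j\in\mathbb{J}\}=\{0\}$. - $\{\Lambda_j\}$ is a g-Riesz basis for $\mathcal{U}$ with respect to $\{\mathcal{V}_j\}$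 if it is g-complete and there are constants $A,B>0$ such that for every finite $\mathbb{J}_1\subset\mathbb{J}$ and all $g_j\in\mathcal{V}_j$ ($j\in\mathbb{J}_1$), $A\sum_{j\in\mathbb{J}_1}\|g_j\|^2\le\|\sum_{j\in\mathbb{J}_1}\Lambda_j^*g_j\|^2\le B\sum_{j\in\mathbb{J}_1}\|g_j\|^2$. - $\{\Lambda_j\}$ is a g-orthonormal basis for $\mathcal{U}$ with respect to $\{\mathcal{V}_j\}$ if $\langle\Lambda_{j_1}^*g_{j_1},\Lambda_{j_2}^*g_{j_2}\rangle=\delta_{j_1,j_2}\langle g_{j_1},g_{j_2}\rangle$ for all $j_1,j_2\in\mathbb{J}$, $g_{j_1}\in\mathcal{V}_{j_1}$, $g_{j_2}\in\mathcal{V}_{j_2}$, and $\sum_{j\in\mathbb{J}}\|\Lambda_jf\|^2=\|f\|^2$ for all $f\in\mathcal{U}$. - The g-frame operator of a g-frame $\{\Lambda_j\}$ is $Sf=\sum_{j\in\mathbb{J}}\Lambda_j^*\Lambda_jf$; it is a bounded invertible operator on $\mathcal{U}$. The canonical dual g-frame of $\{\Lambda_j\}$ is $\{\Lambda_jS^{-1}\}$. - Two g-frames $\{\Lambda_j\}$, $\{\tilde\Lambda_j\}$ are a pair of dual g-frames if $f=\sum_{j\in\mathbb{J}}\Lambda_j^*\tilde\Lambda_jf=\sum_{j\in\mathbb{J}}\tilde\Lambda_j^*\Lambda_jf$ for all $f\in\mathcal{U}$; they are canonical dual g-frames if $\tilde\Lambda_j=\Lambda_jS^{-1}$ for all $j$,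 with $S$ the g-frame operator of $\{\Lambda_j\}$. Frames, Bessel sequences, tight frames, frame operators and Riesz bases are the usual notions: $\{u_i\}$ is a frame for $\mathcal{U}$ if $A\|f\|^2\le\sum_i|\langle f,u_i\rangle|^2\le B\|f\|^2$ for all $f$ and some $A,B>0$ (tight if $A=B$, Bessel if only the upper bound is required); its frame operator is $f\mapsto\sum_i\langle f,u_i\rangle u_i$; a Riesz basis is a complete sequence with $A\sum|c_i|^2\le\|\sum c_iu_i\|^2\le B\sum|c_i|^2$ for all finite scalar sequences and some $A,B>0$. Two frames $\{u_i\},\{\tilde u_i\}$ are dual if $f=\sum_i\langle f,u_i\rangle\tilde u_i=\sum_i\langle f,\tilde u_i\rangle u_i$ for all $f\in\mathcal{U}$, and canonical dual if $\tilde u_i$ is the image of $u_i$ under the inverse of the frame operator of $\{u_i\}$. *)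

(* Defs.v *)
From HB Require Import structures.
From mathcomp Require Import all_boot all_order all_algebra finmap.
From mathcomp Require Import complex.
From mathcomp Require Import all_classical all_reals all_analysis.
From mathcomp.analysis.showcase Require Import summability.

Set Implicit Arguments.
Unset Strict Implicit.
Unset Printing Implicit Defensive.

Import Order.TTheory GRing.Theory Num.Theory.
Import numFieldNormedType.Exports.

Local Open Scope classical_set_scope.
Local Open Scope ring_scope.

(* The scalar field of a Hilbert space is either the reals or the complex
   numbers; all spaces of a given statement share the same scalar field. *)
Variant scalar_kind := RealScalars | ComplexScalars.

Definition scalar_field (R : realType) (k : scalar_kind) : numFieldType :=
  match k with
  | RealScalars => R
  | ComplexScalars => R[i]
  end.

Definition sconj (R : realType) (k : scalar_kind) :
    scalar_field R k -> scalar_field R k :=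
  match k with
  | RealScalars => fun x => x
  | ComplexScalars => @conjc R
  end.

Definition sre (R : realType) (k : scalar_kind) : scalar_field R k -> R :=
  match k with
  | RealScalars => fun x => x
  | ComplexScalars => @complex.Re R
  end.

Fact sconj_is_zmod_morphism (R : realType) (k : scalar_kind) :
  zmod_morphism (@sconj R k).
Proof. by case: k => x y //=; exact: (rmorphB (@conjc R)). Qed.

Fact sconj_is_monoid_morphism (R : realType) (k : scalar_kind) :
  monoid_morphism (@sconj R k).
Proof.
by case: k; split=> //; [exact: (rmorph1 (@conjc R)) | exact: (rmorphM (@conjc R))].
Qed.

HB.instance Definition _ (R : realType) (k : scalar_kind) :=
  GRing.isZmodMorphism.Build (scalar_field R k) (scalar_field R k) (@sconj R k)
    (@sconj_is_zmod_morphism R k).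
HB.instance Definition _ (R : realType) (k : scalar_kind) :=
  GRing.isMonoidMorphism.Build (scalar_field R k) (scalar_field R k) (@sconj R k)
    (@sconj_is_monoid_morphism R k).

(* [{dot U for theta}] is linear in its first argument and theta-semilinear in
   the second one; completeness is inherited from completeNormedModType. *)
HB.mixin Record CompleteNormedModule_isHilbert (R : realType)
    (k : scalar_kind) U of CompleteNormedModule (scalar_field R k) U := {
  inner : {dot U for @sconj R k} ;
  sqr_norm_inner : forall x : U, `|x| ^+ 2 = inner x x
}.

#[short(type="hilbertType")]
HB.structure Definition Hilbert (R : realType) (k : scalar_kind) :=
  {U of CompleteNormedModule_isHilbert R k U &
        CompleteNormedModule (scalar_field R k) U}.

(* MathComp norms take their values in the scalar field; [rnorm] is the same
   norm as an element of R.  It applies to vectors and to scalars. *)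
Definition rnorm (R : realType) (k : scalar_kind)
  (U : normedZmodType (scalar_field R k)) (x : U) : R := sre `|x|.

Section Operators.
Context {R : realType} {k : scalar_kind}.

Definition bounded_operator (U V : hilbertType R k) (T : {linear U -> V}) :=
  exists M : R, forall f, rnorm (T f) <= M * rnorm f.

(* The point T^* g representing f |-> <T f, g>, which exists by the Riesz
   representation theorem when T is a bounded linear operator. *)
Definition adjoint (U V : hilbertType R k) (T : U -> V) (g : V) : U :=
  xget 0 [set x : U | forall f, inner f x = inner (T f) g].

End Operators.

(* Vector-valued sums over a possibly infinite index set D are unconditional
   sums, i.e. limits of the net of finite partial sums. *)
Section UnconditionalSums.
Context {R : realType} {k : scalar_kind} (U : hilbertType R k).
Context (I : choiceType).

Definition finite_sums (D : set I) (x : I -> U) (X : {fset I}) : U :=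
  \sum_(i <- X | i \in D) x i.

Definition has_sum (D : set I) (x : I -> U) (s : U) :=
  finite_sums D x @ totally --> s.

Definition usum (D : set I) (x : I -> U) : U :=
  lim (finite_sums D x @ totally).

End UnconditionalSums.

(* Families are total functions of which only the values on the index set D
   (resp. J) are relevant. *)
Section Sequences.
Context {R : realType} {k : scalar_kind} {U : hilbertType R k}.
Context {I : choiceType}.
Implicit Types (D : set I) (u v : I -> U).

Definition frame_bounds D u (A B : R) := forall f : U,
  ((A * rnorm f ^+ 2)%:E <= \esum_(i in D) (rnorm (inner f (u i)) ^+ 2)%:E /\
   \esum_(i in D) (rnorm (inner f (u i)) ^+ 2)%:E <= (B * rnorm f ^+ 2)%:E)%E.

Definition frame D u :=
  exists A B : R, [/\ 0 < A, 0 < B & frame_bounds D u A B].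

Definition tight_frame D u := exists2 A : R, 0 < A & frame_bounds D u A A.

Definition bessel_sequence D u := exists2 B : R, 0 < B & forall f : U,
  (\esum_(i in D) (rnorm (inner f (u i)) ^+ 2)%:E <= (B * rnorm f ^+ 2)%:E)%E.

Definition linear_span D u : set U :=
  [set x | exists (X : {fset I}) (c : I -> scalar_field R k),
     [set` X] `<=` D /\ x = \sum_(i <- X) c i *: u i].

Definition complete_sequence D u := dense (linear_span D u).

Definition riesz_basis D u :=
  complete_sequence D u /\
  exists A B : R, [/\ 0 < A, 0 < B &
    forall (X : {fset I}) (c : I -> scalar_field R k), [set` X] `<=` D ->
      A * \sum_(i <- X) rnorm (c i) ^+ 2 <= rnorm (\sum_(i <- X) c i *: u i) ^+ 2
      /\
      rnorm (\sum_(i <- X) c i *: u i) ^+ 2 <= B * \sum_(i <- X) rnorm (c i) ^+ 2].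

Definition orthonormal_sequence D u := forall i i', D i -> D i' ->
  inner (u i) (u i') = (i == i')%:R.

Definition orthonormal_basis D u :=
  orthonormal_sequence D u /\ complete_sequence D u.

Definition frame_operator D u (f : U) : U :=
  usum D (fun i => inner f (u i) *: u i).

Definition dual_frames D u v := [/\ frame D u, frame D v,
  forall f, has_sum D (fun i => inner f (u i) *: v i) f &
  forall f, has_sum D (fun i => inner f (v i) *: u i) f].

Definition canonical_dual_frames D u v := [/\ frame D u, frame D v &
  exists T : U -> U,
    [/\ cancel (frame_operator D u) T, cancel T (frame_operator D u) &
        forall i, D i -> v i = T (u i)]].

End Sequences.

Section GSequences.
Context {R : realType} {k : scalar_kind} {U : hilbertType R k}.
Context {I : choiceType} {V : I -> hilbertType R k}.
Implicit Types (J : set I) (L M : forall j, {linear U -> V j}).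

Definition gframe_bounds J L (A B : R) := forall f : U,
  ((A * rnorm f ^+ 2)%:E <= \esum_(j in J) (rnorm (L j f) ^+ 2)%:E /\
   \esum_(j in J) (rnorm (L j f) ^+ 2)%:E <= (B * rnorm f ^+ 2)%:E)%E.

Definition gframe J L :=
  exists A B : R, [/\ 0 < A, 0 < B & gframe_bounds J L A B].

Definition tight_gframe J L := exists2 A : R, 0 < A & gframe_bounds J L A A.

Definition gbessel_sequence J L := exists2 B : R, 0 < B & forall f : U,
  (\esum_(j in J) (rnorm (L j f) ^+ 2)%:E <= (B * rnorm f ^+ 2)%:E)%E.

Definition gcomplete J L :=
  [set f : U | forall j, J j -> L j f = 0] = [set 0].

Definition griesz_basis J L :=
  gcomplete J L /\
  exists A B : R, [/\ 0 < A, 0 < B &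
    forall (X : {fset I}) (g : forall j, V j), [set` X] `<=` J ->
      A * \sum_(j <- X) rnorm (g j) ^+ 2
        <= rnorm (\sum_(j <- X) adjoint (L j) (g j)) ^+ 2
      /\
      rnorm (\sum_(j <- X) adjoint (L j) (g j)) ^+ 2
        <= B * \sum_(j <- X) rnorm (g j) ^+ 2].

(* The identity with the Kronecker delta is split into the cases of equal and
   of distinct indices, as <g, g'> only makes sense within a single V j. *)
Definition gorthonormal_basis J L :=
  [/\ forall j, J j -> forall g g' : V j,
        inner (adjoint (L j) g) (adjoint (L j) g') = inner g g',
      forall j j', J j -> J j' -> j != j' -> forall (g : V j) (g' : V j'),
        inner (adjoint (L j) g) (adjoint (L j') g') = 0 &
      forall f : U,
        (\esum_(j in J) (rnorm (L j f) ^+ 2)%:E = (rnorm f ^+ 2)%:E)%E].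

Definition gframe_operator J L (f : U) : U :=
  usum J (fun j => adjoint (L j) (L j f)).

Definition dual_gframes J L M := [/\ gframe J L, gframe J M,
  forall f, has_sum J (fun j => adjoint (L j) (M j f)) f &
  forall f, has_sum J (fun j => adjoint (M j) (L j f)) f].

Definition canonical_dual_gframes J L M := [/\ gframe J L, gframe J M &
  exists T : U -> U,
    [/\ cancel (gframe_operator J L) T, cancel T (gframe_operator J L) &
        forall j, J j -> forall f, M j f = L j (T f)]].

End GSequences.

(* The Hilbert dimension of U is the cardinality of [hilbert_basis U], an
   orthonormal basis of U given as a set of vectors.  It is compared through
   the relations [#<=] and [#=], and the sum of the dimensions of the V j is
   the cardinality of the disjoint union [hilbert_bases J V]. *)
Section Dimension.
Context {R : realType} {k : scalar_kind}.

Definition hilbert_basis (U : hilbertType R k) : set U :=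
  xget set0 [set B : set U | orthonormal_basis B id].

Definition hilbert_bases (I : choiceType) (J : set I)
    (V : I -> hilbertType R k) : set {j : I & V j} :=
  [set x | J (projT1 x) /\ hilbert_basis (projT2 x)].

End Dimension.

Arguments hilbert_basis {R k} U.
Arguments hilbert_bases {R k I} J V.

Definition induced_sequence {R : realType} {k : scalar_kind}
    {U : hilbertType R k} {V : int -> hilbertType R k}
    (L : forall j, {linear U -> V j}) (e : forall j, int -> V j)
    (p : int * int) : U :=
  adjoint (L p.1) (e p.1 p.2).

(* Main.v *)
From HB Require Import structures.
Require Import Defs.
From mathcomp Require Import all_boot all_order all_algebra finmap.
From mathcomp Require Import complex.
From mathcomp Require Import all_classical all_reals all_analysis.
From mathcomp.analysis.showcase Require Import summability.
From mathcomp Require Import ring lra.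

Set Implicit Arguments.
Unset Strict Implicit.
Unset Printing Implicit Defensive.

Import Order.TTheory GRing.Theory Num.Theory.
Import numFieldNormedType.Exports.

Local Open Scope classical_set_scope.
Local Open Scope ring_scope.

(** The idea is that passing from the operators [L j] to the vectors
    [u (j, i) = (L j)^* (e j i)] only rewrites each [L j f] in coordinates:
    [<f, u (j, i)> = <L j f, e j i>], so Parseval's identity in [V j] and
    Tonelli's theorem for nonnegative sums give
    [sum_j |L j f|^2 = sum_(j, i) |<f, u (j, i)>|^2] ([induced_esum]).  Hence
    frame bounds, Bessel bounds and tightness are literally the same condition
    on both sides.  The adjoint exists by the Riesz representation theorem,
    which is proved here by minimising [|f|^2 - 2 Re (phi f)]; the same
    minimisation over a subspace shows that a family has dense span iff only
    [0] is orthogonal to it ([subspace_representation],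
    [complete_sequenceP]), so that g-completeness is completeness.

    For Riesz bases, a finite combination of the [u p] is grouped by its first
    index into a finite combination of the [(L j)^* g_j], where the squared
    norm of [g_j] is the sum of the squared coefficients
    ([induced_riesz_basis]); conversely the inequalities for arbitrary [g_j]
    are limits of those for the partial sums of their expansions
    ([riesz_basis_induced]).  For orthonormal bases, both sides amount to
    Parseval's identity together with [L j (L j)^* = 1] and
    [L j' (L j)^* = 0] for [j <> j'] ([induced_orthonormal]).

    For frame operators and duality, a Bessel family can be summed unconditionally against any
    square-summable coefficients ([bessel_has_sum]), so
    [sum_(j, i) <f, u (j, i)> v (j, i)] converges; summing first over [i]
    leaves [sum_j (M j)^* (L j f)] with the same sum ([has_sum_sigma]).  Thus
    the series over pairs has sum [s] iff the series over [j] has sum [s]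
    ([induced_has_sumP]).  Duality follows at once; canonical duality follows
    because the inverse of the frame operator is symmetric, so that
    [M j = L j S^-1] iff [(M j)^* (e j i) = S^-1 ((L j)^* (e j i))].

    For the dimensions, a linearly independent family indexed by a countable set is no
    larger than any family with dense span ([complete_card_le]): in finite
    dimension a longer family would have a nontrivial combination orthogonal
    to all the spanning vectors.  This compares orthonormal bases of [U] with
    the frame [u], and, when [u] is a Riesz basis, [u] with an orthonormal
    basis. *)

(** * Scalars *)

Section Scalars.
Context {R : realType} {k : scalar_kind}.
Local Notation F := (scalar_field R k).
Implicit Types (c d : F) (r : R).

Definition of_real : R -> F :=
  match k return R -> scalar_field R k with
  | RealScalars => fun r => r
  | ComplexScalars => fun r => (r%:C)%C
  end.

Lemma sre_is_zmod_morphism : zmod_morphism (@sre R k).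
Proof. by rewrite /sre; case: k => // -[a b] [a' b']. Qed.

Lemma of_real_is_zmod_morphism : zmod_morphism of_real.
Proof. by rewrite /of_real; case: k => // a b /=; rewrite rmorphB. Qed.

Lemma of_real_is_monoid_morphism : monoid_morphism of_real.
Proof. by rewrite /of_real; case: k => //; split=> // a b; rewrite rmorphM. Qed.

End Scalars.

HB.instance Definition _ (R : realType) (k : scalar_kind) :=
  GRing.isZmodMorphism.Build (scalar_field R k) R (@sre R k)
    (@sre_is_zmod_morphism R k).
HB.instance Definition _ (R : realType) (k : scalar_kind) :=
  GRing.isZmodMorphism.Build R (scalar_field R k) (@of_real R k)
    (@of_real_is_zmod_morphism R k).
HB.instance Definition _ (R : realType) (k : scalar_kind) :=
  GRing.isMonoidMorphism.Build R (scalar_field R k) (@of_real R k)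
    (@of_real_is_monoid_morphism R k).

Section ScalarTheory.
Context {R : realType} {k : scalar_kind}.
Local Notation F := (scalar_field R k).
Implicit Types (c d : F) (r : R).

Lemma of_realK r : sre (of_real r : F) = r.
Proof. by rewrite /of_real /sre; case: k. Qed.

Lemma sre_of_realM r c : sre (of_real r * c) = r * sre c.
Proof.
rewrite /of_real /sre; case: k c => //= -[a b]; by rewrite /= mul0r subr0.
Qed.

Lemma of_real_ge0 r : (0 <= (of_real r : F)) = (0 <= r).
Proof. by rewrite /of_real; case: k => //=; rewrite lecR. Qed.

Lemma of_real_gt0 r : (0 < (of_real r : F)) = (0 < r).
Proof. by rewrite /of_real; case: k => //=; rewrite ltcR. Qed.

Lemma ge0_of_real c : 0 <= c -> c = of_real (sre c).
Proof.
rewrite /of_real /sre; case: k c => //= -[a b].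
by rewrite lecE /= => /andP[/eqP-> _].
Qed.

Lemma le_sre c d : c <= d -> sre c <= sre d.
Proof. by rewrite /sre; case: k c d => //= -[a b] [a' b']; rewrite lecE => /andP[]. Qed.

Lemma sconjK : involutive (@sconj R k).
Proof. by rewrite /sconj; case: k => //= -[a b]; rewrite /= opprK. Qed.

Lemma sre_conj c : sre (sconj c) = sre c.
Proof. by rewrite /sre /sconj; case: k c => //= -[a b]. Qed.

Lemma norm_of_real (U : normedZmodType F) (x : U) : `|x| = of_real (rnorm x) :> F.
Proof. by rewrite /rnorm -ge0_of_real. Qed.

Lemma mul_conj c : c * sconj c = of_real (rnorm c ^+ 2).
Proof.
rewrite rmorphXn /= -norm_of_real; move: c; rewrite /sconj /=.
case: k => /= c; first by rewrite real_normK ?num_real.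
by rewrite sqr_normc.
Qed.

Lemma rnorm_conj c : rnorm (sconj c) = rnorm c.
Proof.
have h : rnorm (sconj c) ^+ 2 = rnorm c ^+ 2.
  by rewrite -[LHS](@of_realK) -mul_conj sconjK mulrC mul_conj of_realK.
by apply/eqP; move/eqP: h; rewrite eqrXn2 // -(of_real_ge0 (rnorm _)) -norm_of_real.
Qed.

Lemma sre_le_rnorm c : sre c <= rnorm c.
Proof.
rewrite /rnorm /sre; move: c; case: k => /= c; first exact: ler_norm.
have := normc_ge_Re c; rewrite lecE /= => /andP[_]; exact: le_trans (ler_norm _).
Qed.

Section Rnorm.
Context {U : normedZmodType F}.
Implicit Types x y : U.

Lemma rnorm_ge0 x : 0 <= rnorm x.
Proof. by rewrite -(of_real_ge0 (rnorm x)) -norm_of_real. Qed.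

Lemma rnorm0 : rnorm (0 : U) = 0.
Proof. by rewrite /rnorm normr0 raddf0. Qed.

Lemma rnorm0_eq0 x : rnorm x = 0 -> x = 0.
Proof. by move=> x0; apply/normr0_eq0; rewrite norm_of_real x0 raddf0. Qed.

Lemma rnormN x : rnorm (- x) = rnorm x.
Proof. by rewrite /rnorm normrN. Qed.

Lemma rnormBC x y : rnorm (x - y) = rnorm (y - x).
Proof. by rewrite -rnormN opprB. Qed.

Lemma rnormD x y : rnorm (x + y) <= rnorm x + rnorm y.
Proof. by rewrite /rnorm -raddfD; apply/le_sre/ler_normD. Qed.

Lemma rnormB x y : rnorm (x - y) <= rnorm x + rnorm y.
Proof. by rewrite -(rnormN y) rnormD. Qed.

Lemma rnorm_le_eq0 x : (forall e : R, 0 < e -> rnorm x <= e) -> x = 0.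
Proof.
move=> h; apply/rnorm0_eq0/le_anti; rewrite rnorm_ge0 andbT.
by apply/ler_addgt0Pl => e e0; rewrite addr0; apply: h.
Qed.

Lemma rnorm_lt_of_real x r : (`|x| < of_real r :> F) = (rnorm x < r).
Proof. by rewrite norm_of_real -subr_gt0 -raddfB of_real_gt0 subr_gt0. Qed.

End Rnorm.

Lemma rnormZ (U : normedModType F) (a : F) (x : U) :
  rnorm (a *: x) = rnorm a * rnorm x.
Proof. by rewrite {1}/rnorm normrZ !norm_of_real -rmorphM of_realK. Qed.

Lemma rnormM c d : rnorm (c * d) = rnorm c * rnorm d.
Proof. exact: (@rnormZ F^o). Qed.

Lemma rnorm_of_real r : 0 <= r -> rnorm (of_real r : F) = r.
Proof. by move=> r0; rewrite /rnorm ger0_norm ?of_real_ge0 ?of_realK. Qed.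

Lemma rnorm_of_real_norm r : rnorm (of_real r : F) = `|r|.
Proof.
have [r0|r0] := leP 0 r; first by rewrite rnorm_of_real ?ger0_norm.
by rewrite -rnormN -(raddfN of_real) rnorm_of_real ?oppr_ge0 ?ltW // ltr0_norm.
Qed.

End ScalarTheory.

(** * Inner products and minimisation *)

Section InnerProduct.
Context {R : realType} {k : scalar_kind} {U : hilbertType R k}.
Local Notation F := (scalar_field R k).
Implicit Types (x y z : U) (a : F).

Lemma innerC x y : inner x y = sconj (inner y x).
Proof. by rewrite hermC /= expr0 mul1r. Qed.

Lemma inner0l x : inner 0 x = 0. Proof. exact: linear0l. Qed.
Lemma inner0r x : inner x 0 = 0. Proof. exact: linear0r. Qed.
Lemma innerDl x y z : inner (x + y) z = inner x z + inner y z.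
Proof. exact: linearDl. Qed.
Lemma innerDr x y z : inner z (x + y) = inner z x + inner z y.
Proof. exact: linearDr. Qed.
Lemma innerBl x y z : inner (x - y) z = inner x z - inner y z.
Proof. exact: linearBl. Qed.
Lemma innerBr x y z : inner z (x - y) = inner z x - inner z y.
Proof. exact: linearBr. Qed.
Lemma innerZl a x y : inner (a *: x) y = a * inner x y.
Proof. exact: linearZl_LR. Qed.
Lemma innerZr a x y : inner x (a *: y) = sconj a * inner x y.
Proof. exact: linearZr_LR. Qed.
Lemma inner_suml I (r : seq I) (P : pred I) (E : I -> U) y :
  inner (\sum_(i <- r | P i) E i) y = \sum_(i <- r | P i) inner (E i) y.
Proof. exact: linear_sumlz. Qed.
Lemma inner_sumr I (r : seq I) (P : pred I) (E : I -> U) y :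
  inner y (\sum_(i <- r | P i) E i) = \sum_(i <- r | P i) inner y (E i).
Proof. exact: linear_sumr. Qed.

Lemma inner_self x : inner x x = of_real (rnorm x ^+ 2).
Proof. by rewrite -sqr_norm_inner norm_of_real rmorphXn. Qed.

Lemma rnorm_sqr x : rnorm x ^+ 2 = sre (inner x x).
Proof. by rewrite inner_self of_realK. Qed.

Lemma sre_innerC x y : sre (inner x y) = sre (inner y x).
Proof. by rewrite innerC sre_conj. Qed.

Lemma rnorm_innerC x y : rnorm (inner x y) = rnorm (inner y x).
Proof. by rewrite innerC rnorm_conj. Qed.

Lemma rnormD_sqr x y :
  rnorm (x + y) ^+ 2 = rnorm x ^+ 2 + rnorm y ^+ 2 + 2 * sre (inner x y).
Proof.
rewrite !rnorm_sqr innerDl !innerDr !raddfD /= (sre_innerC y x); ring.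
Qed.

Lemma rnormB_sqr x y :
  rnorm (x - y) ^+ 2 = rnorm x ^+ 2 + rnorm y ^+ 2 - 2 * sre (inner x y).
Proof.
by rewrite rnormD_sqr rnormN -[- y]scaleN1r innerZr rmorphN1 mulN1r raddfN mulrN.
Qed.

Lemma parallelogram x y :
  rnorm (x - y) ^+ 2 = 2 * rnorm x ^+ 2 + 2 * rnorm y ^+ 2 - rnorm (x + y) ^+ 2.
Proof. rewrite rnormB_sqr rnormD_sqr; ring. Qed.

(** The triangle inequality is available beforehand because the norm is given
    together with the inner product; comparing the squares of its two sides
    bounds the real part. *)
Lemma sre_inner_le x y : sre (inner x y) <= rnorm x * rnorm y.
Proof.
have := rnormD_sqr x y; have := rnormD x y.
have := rnorm_ge0 (x + y); have := rnorm_ge0 x; have := rnorm_ge0 y; nra.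
Qed.

(** Scaling [y] by [<x, y>] makes the inner product real, which reduces the
    claim to its real part. *)
Lemma Cauchy_Schwarz x y : rnorm (inner x y) <= rnorm x * rnorm y.
Proof.
have [->|n0] := eqVneq (rnorm (inner x y)) 0.
  by rewrite mulr_ge0 ?rnorm_ge0.
have n1 : 0 < rnorm (inner x y) by rewrite lt_def n0 rnorm_ge0.
have := sre_inner_le x (inner x y *: y).
by rewrite innerZr mulrC mul_conj of_realK rnormZ mulrCA expr2 ler_pM2l.
Qed.

Lemma eq_inner x y : (forall f, inner f x = inner f y) -> x = y.
Proof.
move=> h; apply/eqP; rewrite -subr_eq0; apply/eqP/rnorm0_eq0/eqP.
by rewrite -sqrf_eq0 rnorm_sqr innerBr h subrr raddf0.
Qed.

Lemma cvg_rnormP {T} (G : set_system T) {FG : Filter G} (f : T -> U) (l : U) :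
  f @ G --> l <->
  forall e : R, 0 < e -> \forall t \near G, rnorm (l - f t) < e.
Proof.
split=> [/cvgrPdist_lt h e e0|h].
  have := h (of_real e); rewrite of_real_gt0 => /(_ e0).
  by apply: filterS => t; rewrite rnorm_lt_of_real.
apply/cvgrPdist_lt => e e0; have e1 := ge0_of_real (ltW e0).
move: e0; rewrite e1 of_real_gt0 => e0.
by apply: filterS (h _ e0) => t; rewrite rnorm_lt_of_real.
Qed.

Lemma closureP (A : set U) x :
  closure A x <-> forall e : R, 0 < e -> exists2 y, A y & rnorm (x - y) < e.
Proof.
split=> [h e e0|h B].
  have /h[y [Ay xy]] : nbhs x (ball x (of_real e : F)).
    by apply: nbhsx_ballx; rewrite of_real_gt0.
  by exists y => //; move: xy; rewrite -ball_normE /= rnorm_lt_of_real.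
move=> /nbhs_ballP[e /= e0]; have e1 := ge0_of_real (ltW e0).
move: e0; rewrite e1 of_real_gt0 => e0 eB.
have [y Ay xy] := h _ e0; exists y; split=> //; apply: eB.
by rewrite -ball_normE /= rnorm_lt_of_real.
Qed.

Lemma denseP (A : set U) : dense A <-> forall x, closure A x.
Proof.
split=> [h x B|h B].
  rewrite nbhsE => -[C [Co Cx] CB].
  have [|y [Cy Ay]] := h C _ Co; first by exists x.
  by exists y; split=> //; exact: CB.
move=> [x Bx] Bo; have [|y [Ay By]] := h x B; first by exact: open_nbhs_nbhs.
by exists y.
Qed.

Lemma rnorm_complete {T} (G : set_system T) {FG : ProperFilter G} (f : T -> U) :
  (forall e : R, 0 < e -> exists x, \forall t \near G, rnorm (x - f t) < e) ->
  exists l : U, f @ G --> l.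
Proof.
move=> h; suff : cvg (f @ G : set_system U) by move=> h'; exists (lim (f @ G : set_system U)).
apply/cauchy_cvgP/cauchy_exP => e e0; have e1 := ge0_of_real (ltW e0).
move: e0; rewrite e1 of_real_gt0 => /h[x hx]; exists x.
by apply: filterS hx => t; rewrite -ball_normE /= rnorm_lt_of_real.
Qed.

Lemma rnorm_sqr_lt x (e : R) : 0 < e -> rnorm x ^+ 2 < e ^+ 2 -> rnorm x < e.
Proof. by move=> e0; rewrite ltr_pXn2r // nnegrE ?rnorm_ge0 ?ltW. Qed.

(** A function with a minimum at [0] has zero derivative there.  The test
    point is [t = - a / (b + 1)], the vertex of the parabola up to the [+ 1]
    that avoids dividing by zero. *)
Lemma quadratic_ge0_eq0 (a b : R) : (forall t, 0 <= 2 * t * a + t ^+ 2 * b) -> a = 0.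
Proof.
move=> h; have b0 : 0 <= b by have := h 1; have := h (-1); nra.
have := h (- a / (b + 1)); rewrite (_ : _ + _ = - (b + 2) * (a / (b+1))^+2).
  rewrite mulNr oppr_ge0 pmulr_rle0 ?ltr_wpDl// => h1.
  have : (a / (b + 1)) ^+ 2 == 0 by rewrite eq_le h1 sqr_ge0.
  rewrite sqrf_eq0 mulf_eq0 invr_eq0 => /orP[/eqP//|/eqP]; lra.
by field; lra.
Qed.

Section Minimization.
Variables (phi : U -> F) (M : R) (W : set U).
Hypothesis phiP : forall a x y, phi (a *: x + y) = a * phi x + phi y.
Hypothesis phiM : forall x, rnorm (phi x) <= M * rnorm x.
Hypothesis W0 : W 0.
Hypothesis WP : forall a x y, W x -> W y -> W (a *: x + y).

(* [Q f] is [|f - r|^2 - |r|^2] if [r] represents [phi], so its minimiser over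
   [W] is the projection of [r]; the sets of near minimisers form the base of a
   filter [G]. *)
Let Q f := rnorm f ^+ 2 - 2 * sre (phi f).
Let m := inf [set Q f | f in W].
Let G := filter_from [set e : R | 0 < e] (fun e => [set f | W f /\ Q f < m + e]).

Let Qlb : has_inf [set Q f | f in W].
Proof.
split; first by exists (Q 0), 0.
exists (- M ^+ 2) => _ [f Wf <-]; rewrite /Q.
have h1 := sre_le_rnorm (phi f); have h2 := phiM f.
have h3 := sqr_ge0 (rnorm f - M); rewrite sqrrB -mulr_natl in h3; lra.
Qed.

Let m_le f : W f -> m <= Q f.
Proof. by move=> Wf; apply: ge_inf; [case: Qlb|exists f]. Qed.

#[local] Instance G_filter : ProperFilter G.
Proof.
apply: filter_from_proper; last first.
  move=> e e0; have [_ [f Wf <-] fe] := inf_adherent e0 Qlb.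
  by exists f.
apply: filter_from_filter; first by exists 1 => /=.
move=> e1 e2 /= p1 p2; exists (Num.min e1 e2) => /=; first by rewrite lt_min p1.
by move=> f [Wf]; rewrite -ltrBlDl lt_min => /andP[h1 h2]; do !split=> //; lra.
Qed.

Let phiD x y : phi (x + y) = phi x + phi y.
Proof. by rewrite -[x]scale1r phiP mul1r scale1r. Qed.
Let phi0 : phi 0 = 0.
Proof. by apply: (@addrI _ (phi 0)); rewrite -phiD !addr0. Qed.
Let phiZ a x : phi (a *: x) = a * phi x.
Proof. by rewrite -[a *: x]addr0 phiP phi0 addr0. Qed.

(** Near minimisers of [Q] are close to each other by the parallelogram law,
    hence converge to some [l] in the closure of [W]; the first variation of
    [Q] at [l] vanishes in every direction of [W].  With [W] the whole space
    this is the Riesz representation theorem, and with [phi] the inner product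
    against [x] it is the orthogonal projection of [x]. *)
Lemma subspace_representation :
  exists2 l, closure W l & forall g, W g -> phi g = inner g l.
Proof.
have [l Gl] : exists l : U, id @ G --> l.
  apply: (@rnorm_complete _ G _ id) => e e0.
  have e1 : 0 < e ^+ 2 / 4 by rewrite divr_gt0 ?exprn_gt0.
  have [_ [x Wx <-] fx] := inf_adherent e1 Qlb; exists x.
  exists (e ^+ 2 / 4) => //= f [Wf ff]; apply: rnorm_sqr_lt => //.
  rewrite parallelogram.
  have /m_le : W (of_real 2^-1 *: (x + f)).
    by rewrite -[_ *: _]addr0; apply: WP => //; rewrite -[x]scale1r; apply: WP.
  rewrite /Q rnormZ phiZ sre_of_realM rnorm_of_real // phiD raddfD /=.
  rewrite exprMn; rewrite -/m in fx; move: fx ff; rewrite /Q; nra.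
have near e : 0 < e -> exists f, [/\ W f, Q f < m + e & rnorm (l - f) < e].
  move=> e0; have /cvg_rnormP/(_ _ e0) := Gl; case=> d /= d0 dP.
  have e1 : 0 < Num.min d e by rewrite lt_min d0.
  have [_ [f Wf <-] fe] := inf_adherent e1 Qlb; rewrite -/m -ltrBlDl lt_min in fe.
  exists f; split=> //; first lra.
  by apply: dP; split=> //; lra.
exists l; first by apply/closureP => e /near[f [Wf _ lf]]; exists f.
have re g : W g -> sre (inner g l) - sre (phi g) = 0.
  move=> Wg; apply: (@quadratic_ge0_eq0 _ (rnorm g ^+ 2)) => t.
  rewrite leNgt; apply/negP => h.
  (* The limit [l] need not lie in [W], so the variation is computed at a near
     minimiser [f] whose error [- c / C] is too small to compensate [c < 0]. *)
  set c := 2 * t * _ + _ in h.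
  pose C := 1 + 2 * `|t| * rnorm g.
  have C0 : 0 < C by rewrite /C ltr_wpDr // !mulr_ge0 ?rnorm_ge0.
  have e0 : 0 < - c / C by rewrite divr_gt0 // oppr_gt0.
  have [f [Wf fe lf]] := near _ e0.
  have /m_le : W (of_real t *: g + f) by apply: WP.
  rewrite /Q rnormD_sqr rnormZ phiP raddfD /= sre_of_realM innerZl sre_of_realM exprMn.
  rewrite rnorm_of_real_norm real_normK ?num_real //.
  have s1 := sre_inner_le g (f - l); have s2 := sre_inner_le g (l - f).
  move: s1 s2; rewrite (rnormBC f) !innerBr !raddfB /= => s1 s2.
  have lg : rnorm g * rnorm (l - f) <= rnorm g * (- c / C).
    by rewrite ler_wpM2l ?rnorm_ge0 // ltW.
  have ts : t * (sre (inner g f) - sre (inner g l)) <=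
            `|t| * (rnorm g * (- c / C)).
    apply: (le_trans (ler_norm _)); rewrite normrM ler_wpM2l //.
    by rewrite ler_norml; apply/andP; split; lra.
  have cC : - c / C * C = - c by rewrite divfK ?gt_eqF.
  move: fe cC ts; rewrite /C /Q /c; move: (- _ / _) => e fe cC ts hm.
  nra.
have re' g : W g -> sre (inner g l - phi g) = 0 by move/re; rewrite raddfB.
move=> g Wg; apply/eqP; rewrite eq_sym -subr_eq0; apply/eqP.
(* Only real parts are known to agree; in the direction [d^* g] the defect is
   [d^* d = |d|^2], which is real. *)
set d := _ - _; have := re' (sconj d *: g).
rewrite -[_ *: g]addr0 => /(_ (WP _ Wg W0)).
rewrite addr0 innerZl phiZ -mulrBr mulrC mul_conj of_realK => /eqP.
by rewrite sqrf_eq0 => /eqP/rnorm0_eq0.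
Qed.

End Minimization.

End InnerProduct.

(** * Adjoints and unconditional sums *)

Section Adjoint.
Context {R : realType} {k : scalar_kind} {U V : hilbertType R k}.
Variable T : {linear U -> V}.
Hypothesis Tb : bounded_operator T.

Lemma adjointP g f : inner f (adjoint T g) = inner (T f) g.
Proof.
have [M TM] := Tb.
suff : exists x, forall f, inner f x = inner (T f) g.
  by move=> h; have := xgetPex 0 h.
have [||//|//|x _ h] := @subspace_representation R k U
  (fun f => inner (T f) g) (M * rnorm g) setT.
- by move=> a x y; rewrite linearP innerDl innerZl.
- move=> x; apply: le_trans (Cauchy_Schwarz _ _) _.
  by rewrite mulrAC ler_wpM2r ?rnorm_ge0.
- by exists x => f'; rewrite h.
Qed.

Lemma adjoint_unique g x : (forall f, inner f x = inner (T f) g) -> adjoint T g = x.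
Proof. by move=> h; apply: eq_inner => f'; rewrite adjointP h. Qed.

Lemma adjoint_linear : linear (adjoint T).
Proof.
move=> a g h; apply: adjoint_unique => f.
by rewrite innerDr innerZr !adjointP innerDr innerZr.
Qed.

Lemma adjointD g h : adjoint T (g + h) = adjoint T g + adjoint T h.
Proof. by rewrite -[g]scale1r adjoint_linear !scale1r. Qed.

Lemma adjoint0 : adjoint T 0 = 0.
Proof. by apply: adjoint_unique => f; rewrite !inner0r. Qed.

Lemma adjointZ a g : adjoint T (a *: g) = a *: adjoint T g.
Proof. by rewrite -[a *: g]addr0 adjoint_linear adjoint0 addr0. Qed.

Lemma adjointB g h : adjoint T (g - h) = adjoint T g - adjoint T h.
Proof. by rewrite adjointD -scaleN1r adjointZ scaleN1r. Qed.

Lemma adjoint_sum I (r : seq I) (P : pred I) (E : I -> V) :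
  adjoint T (\sum_(i <- r | P i) E i) = \sum_(i <- r | P i) adjoint T (E i).
Proof.
elim/big_rec2: _ => [|i x y _ <-]; first exact: adjoint0.
by rewrite adjointD.
Qed.

(** This is read off from [|T^* g|^2 = <T (T^* g), g>]. *)
Lemma adjoint_bounded : exists2 M : R, 0 < M & forall g, rnorm (adjoint T g) <= M * rnorm g.
Proof.
have [M TM] := Tb; exists (`|M| + 1); first by rewrite ltr_wpDl.
move=> g; have [->|n0] := eqVneq (rnorm (adjoint T g)) 0.
  by rewrite mulr_ge0 ?rnorm_ge0 // addr_ge0.
have n1 : 0 < rnorm (adjoint T g) by rewrite lt_def n0 rnorm_ge0.
rewrite -(ler_pM2r n1) -expr2 rnorm_sqr adjointP.
apply: le_trans (sre_inner_le _ _) _.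
rewrite mulrAC ler_wpM2r ?rnorm_ge0 //; apply: le_trans (TM _) _.
by rewrite ler_pM2r // (le_trans (ler_norm M)) // lerDl.
Qed.

End Adjoint.

Section ScalarSums.
Context {R : realType} {I : choiceType}.
Implicit Types (D : set I) (a : I -> R) (X Y : {fset I}).

Lemma big_fsetU_disjoint {M : nmodType} X Y (a : I -> M) : [disjoint X & Y]%fset ->
  \sum_(i <- (X `|` Y)%fset) a i = \sum_(i <- X) a i + \sum_(i <- Y) a i.
Proof.
move=> XY; rewrite -big_cat /=; apply/perm_big/uniq_perm; rewrite ?fset_uniq //.
  rewrite cat_uniq !fset_uniq andbT /=; apply/hasPn => i iY.
  by apply/negP => /= iX; move/fdisjointP: XY => /(_ i iX); rewrite iY.
by move=> i; rewrite inE mem_cat.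
Qed.

Lemma esum_leP D a C : (forall i, 0 <= a i) ->
  (\esum_(i in D) (a i)%:E <= C%:E)%E <->
  forall X, [set` X] `<=` D -> \sum_(i <- X) a i <= C.
Proof.
move=> a0; split=> [h X XD|h].
  rewrite -lee_fin; apply: le_trans h; apply: esum_ge; exists [set` X].
    by split=> //; exact: finite_fset.
  by rewrite fsbig_finite ?finite_fset//= set_fsetK sumEFin.
apply: ge_ereal_sup => _ [X [finX XD] <-].
rewrite fsbig_finite //= sumEFin lee_fin; apply: h.
by move=> i /=; rewrite in_fset_set // inE; exact: XD.
Qed.

(** The set [X] nearly attains the supremum of the finite sums. *)
Lemma esum_tail D a C e : (forall i, 0 <= a i) ->
  (\esum_(i in D) (a i)%:E <= C%:E)%E -> 0 < e ->
  exists X, forall Y, [set` Y] `<=` D -> [disjoint X & Y]%fset ->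
    \sum_(i <- Y) a i < e.
Proof.
move=> a0 aC e0.
pose A := [set \sum_(i <- X) a i | X in [set X : {fset I} | [set` X] `<=` D]].
have hA : has_sup A.
  split; first by exists 0, fset0 => //; rewrite ?big_seq_fset0.
  by exists C => _ [X XD <-]; move/esum_leP : aC; apply.
have [_ [X XD <-] Xe] := sup_adherent e0 hA; exists X => Y YD XY.
have : \sum_(i <- (X `|` Y)%fset) a i <= sup A.
  apply: ub_le_sup; first by case: hA.
  exists (X `|` Y)%fset => // i /=; rewrite inE => /orP[/XD//|/YD//].
rewrite big_fsetU_disjoint //; lra.
Qed.

End ScalarSums.

#[local] Existing Instance totally_filter.

Section UnconditionalSums.
Context {R : realType} {k : scalar_kind} {U : hilbertType R k} {I : choiceType}.
Implicit Types (D : set I) (x y : I -> U) (X Y : {fset I}).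

Lemma rnorm_sum (T : Type) (r : seq T) (P : pred T) (f : T -> U) :
  rnorm (\sum_(i <- r | P i) f i) <= \sum_(i <- r | P i) rnorm (f i).
Proof.
elim/big_rec2: _ => [|i a b _ h]; first by rewrite rnorm0.
by apply: le_trans (rnormD _ _) _; rewrite lerD2l.
Qed.

Lemma finite_sums_filter D x X :
  finite_sums D x X = \sum_(i <- [fset i in X | i \in D]%fset) x i.
Proof. by rewrite big_fset. Qed.

Lemma sub_fset_filter D X : [set` [fset i in X | i \in D]%fset] `<=` D.
Proof. by move=> i /=; rewrite !inE /= => /andP[_]; rewrite inE. Qed.

Lemma has_sumP D x s : has_sum D x s <->
  forall e : R, 0 < e -> exists X0, forall X, (X0 `<=` X)%fset ->
    rnorm (s - finite_sums D x X) < e.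
Proof.
rewrite /has_sum (cvg_rnormP (G := totally)); split=> h e /h.
  by move=> [X0 _ hX]; exists X0.
by move=> [X0 hX]; exists X0.
Qed.

Lemma has_sum_unique D x s t : has_sum D x s -> has_sum D x t -> s = t.
Proof. exact: cvg_unique. Qed.

Lemma usum_eq D x s : has_sum D x s -> usum D x = s.
Proof. exact: cvg_lim. Qed.

Lemma eq_has_sum D x y s : (forall i, D i -> x i = y i) -> has_sum D x s -> has_sum D y s.
Proof.
move=> xy; rewrite /has_sum.
suff -> : finite_sums D x = finite_sums D y by [].
by apply/funext => X; apply: eq_bigr => i; rewrite inE => /xy.
Qed.

(** The Cauchy criterion for unconditional sums: finite blocks outside a large
    enough finite set are small. *)
Lemma has_sum_complete D x :
  (forall e : R, 0 < e -> exists X, forall Y, [set` Y] `<=` D -> [disjoint X & Y]%fset ->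
    rnorm (\sum_(i <- Y) x i) < e) ->
  exists s, has_sum D x s.
Proof.
move=> h; apply: rnorm_complete => e /h[X hX]; exists (finite_sums D x X).
exists X => // Y /= XY; rewrite rnormBC.
rewrite (_ : _ - _ = \sum_(i <- [fset i in (Y `\` X)%fset | i \in D]%fset) x i).
  apply: hX; first exact: sub_fset_filter.
  by apply/fdisjointP => i iX; rewrite !inE iX.
rewrite -(finite_sums_filter D x (Y `\` X)%fset); apply/eqP; rewrite subr_eq addrC; apply/eqP.
rewrite /finite_sums big_mkcond [X in _ = X + _]big_mkcond [X in _ = _ + X]big_mkcond.
rewrite -big_fsetU_disjoint ?fsetUDl; last first.
  by apply/fdisjointP => i iX; rewrite !inE iX.
have -> : ((X `|` Y) `\` (X `\` X) = Y)%fset.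
  apply/fsetP => i; rewrite !inE andNb /=.
  by case: (boolP (i \in X)) => // /(fsubsetP XY) ->.
by [].
Qed.

End UnconditionalSums.

(** Associativity of unconditional sums.  Over a finite set [Y] of first
    indices, each fibre sum is replaced by a finite part [Z j] at cost
    [e / 2 / (n + 1)], where [n] is the size of [Y]; the union of these parts
    contains the finite set beyond which the sums over pairs are within [e / 2]
    of the total. *)
Lemma has_sum_sigma {R : realType} {k : scalar_kind} {U : hilbertType R k}
    {I1 I2 : choiceType} (J : set I1) (K : I1 -> set I2) (x : I1 * I2 -> U)
    (y : I1 -> U) s :
  has_sum (J `*`` K) x s ->
  (forall j, J j -> has_sum (K j) (fun i => x (j, i)) (y j)) ->
  has_sum J y s.
Proof.
move=> /has_sumP xs xy; apply/has_sumP => e e0.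
have e2 : 0 < e / 2 by lra.
have [X0 hX0] := xs _ e2.
exists [fset p.1 | p in X0]%fset => Y YX0.
pose d := e / 2 / (#|`Y|.+1)%:R.
have d0 : 0 < d by rewrite divr_gt0.
have /choice[Z hZ] : forall j, exists Z : {fset I2}, ([fset p.2 | p in X0] `<=` Z)%fset /\
    (J j -> rnorm (y j - finite_sums (K j) (fun i => x (j, i)) Z) < d).
  move=> j; have [Jj|nJ] := pselect (J j); last by exists [fset p.2 | p in X0]%fset.
  have /has_sumP/(_ _ d0)[Z0 hZ0] := xy _ Jj.
  exists ([fset p.2 | p in X0] `|` Z0)%fset; split; first exact: fsubsetUl.
  by move=> _; apply: hZ0; exact: fsubsetUr.
pose X := [fset ((j, i) : I1 * I2) | j in Y, i in Z j]%fset.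
have memJK j i : ((j, i) \in J `*`` K) = (j \in J) && (i \in K j).
  by apply/idP/andP => [/set_mem[/= a b]|[/set_mem a /set_mem b]];
    [split; exact: mem_set|exact: mem_set].
have X0X : (X0 `<=` X)%fset.
  apply/fsubsetP => -[j i] ji; apply/imfset2P; exists j => /=.
    by apply: (fsubsetP YX0); apply/imfsetP; exists (j, i).
  exists i => //=; have [/fsubsetP h _] := hZ j.
  by apply: h; apply/imfsetP; exists (j, i).
have -> : finite_sums J y Y = finite_sums (J `*`` K) x X +
    \sum_(j <- Y | j \in J) (y j - finite_sums (K j) (fun i => x (j, i)) (Z j)).
  rewrite big_split /= addrCA -[LHS]addr0; congr (_ + _).
  rewrite /finite_sums /= big_mkcond big_imfset2 /=; last by move=> [? ?] [? ?] _ _ /= [-> ->].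
  rewrite sumrN; apply/esym/eqP; rewrite subr_eq0 [X in _ == X]big_mkcond; apply/eqP.
  apply: eq_bigr => j _; case: ifPn => Jj.
    by rewrite [RHS]big_mkcond; apply: eq_bigr => i _; rewrite memJK Jj.
  by apply: big1 => i _; rewrite memJK (negPf Jj).
rewrite opprD addrA; apply: le_lt_trans (rnormB _ _) _.
have h1 := hX0 _ X0X.
suff h2 : rnorm (\sum_(j <- Y | j \in J) (y j - finite_sums (K j) (fun i => x (j, i)) (Z j)))
    <= e / 2 by lra.
apply: le_trans (rnorm_sum _ _ _) _.
apply: (@le_trans _ _ (\sum_(j <- Y) d)).
  rewrite big_mkcond; apply: ler_sum => j _; case: ifP => [|_]; last exact: ltW.
  by rewrite inE => Jj; apply/ltW/(hZ j).2.
rewrite big_const_seq count_predT iter_addr_0 -[d *+ _]mulr_natr /d mulrAC.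
by rewrite ler_pdivrMr ?ltr0n // ler_pM2l // ler_nat leqnSn.
Qed.

(** * Dense spans, orthonormal families, Bessel families and limits *)

Section Spans.
Context {R : realType} {k : scalar_kind} {U : hilbertType R k} {I : choiceType}.
Local Notation F := (scalar_field R k).
Implicit Types (D : set I) (u v : I -> U) (X Y : {fset I}).

Lemma sum_extend u (c : I -> F) X Y : (X `<=` Y)%fset ->
  \sum_(i <- X) c i *: u i = \sum_(i <- Y) (if i \in X then c i else 0) *: u i.
Proof.
move=> XY; rewrite -(big_fset_incl _ XY) => [|i _ /negPf->]; last exact: scale0r.
by rewrite !big_seq; apply: eq_bigr => i ->.
Qed.

Lemma linear_span0 D u : linear_span D u 0.
Proof. by exists fset0, (fun=> 0); split=> //; rewrite big_seq_fset0. Qed.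

Lemma linear_spanP D u a x y : linear_span D u x -> linear_span D u y ->
  linear_span D u (a *: x + y).
Proof.
move=> [X [c [XD ->]]] [Y [d [YD ->]]].
rewrite (sum_extend _ _ (fsubsetUl X Y)) (sum_extend _ _ (fsubsetUr X Y)).
exists (X `|` Y)%fset, (fun i => a * (if i \in X then c i else 0) +
  (if i \in Y then d i else 0)); split.
  by move=> i /=; rewrite inE => /orP[/XD|/YD].
rewrite scaler_sumr -big_split; apply: eq_bigr => i _ /=.
by rewrite scalerA scalerDl.
Qed.

Lemma linear_span_mem D u i : D i -> linear_span D u (u i).
Proof.
move=> Di; exists [fset i]%fset, (fun=> 1); split.
  by move=> j /=; rewrite inE => /eqP->.
by rewrite big_seq_fset1 scale1r.
Qed.

(** If only [0] is orthogonal to the family, then any [x] equals its orthogonal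
    projection on the closure of the span. *)
Lemma complete_sequenceP D u : complete_sequence D u <->
  forall f, (forall i, D i -> inner f (u i) = 0) -> f = 0.
Proof.
rewrite /complete_sequence denseP; split=> [h f fu|h x].
  apply: rnorm_le_eq0 => e /((closureP _ _).1 (h f))[_ [X [c [XD ->]]] /ltW].
  set y := \sum_(i <- _) _.
  have fy : inner f y = 0.
    rewrite /y inner_sumr big_seq big1 // => i /XD Di.
    by rewrite innerZr fu // mulr0.
  apply: le_trans; have [->|n0] := eqVneq (rnorm f) 0; first exact: rnorm_ge0.
  have n1 : 0 < rnorm f by rewrite lt_def n0 rnorm_ge0.
  rewrite -(ler_pM2l n1) -expr2 rnorm_sqr -[inner f f]subr0 -fy -innerBr.
  exact: sre_inner_le.
have [||||l ll lx] := @subspace_representation R k U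
  (fun f => inner f x) (rnorm x) (linear_span D u).
- by move=> a y z; rewrite innerDl innerZl.
- by move=> y; rewrite mulrC Cauchy_Schwarz.
- exact: linear_span0.
- exact: linear_spanP.
suff -> : x = l by [].
apply/eqP; rewrite -subr_eq0; apply/eqP/h => i Di.
by rewrite innerC innerBr lx ?subrr ?rmorph0 //; exact: linear_span_mem.
Qed.

Lemma eq_complete D u : complete_sequence D u -> forall f g,
  (forall i, D i -> inner f (u i) = inner g (u i)) -> f = g.
Proof.
move=> /complete_sequenceP h f g fg; apply/eqP; rewrite -subr_eq0; apply/eqP/h => i Di.
by rewrite innerBl fg // subrr.
Qed.

Section Orthonormal.
Context {D : set I} {u : I -> U}.
Hypothesis uo : orthonormal_sequence D u.

Lemma orthonormal_coef X c i : [set` X] `<=` D -> i \in X ->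
  inner (\sum_(j <- X) c j *: u j) (u i) = c i.
Proof.
move=> XD iX; rewrite inner_suml (big_fsetD1 i) //= innerZl uo ?eqxx ?mulr1; last 2 first.
- exact: XD.
- exact: XD.
rewrite big_seq big1 ?addr0 // => j; rewrite !inE => /andP[ji jX].
by rewrite innerZl uo ?(negPf ji) ?mulr0 //; exact: XD.
Qed.

Lemma orthonormal_rnorm_sum X c : [set` X] `<=` D ->
  rnorm (\sum_(i <- X) c i *: u i) ^+ 2 = \sum_(i <- X) rnorm (c i) ^+ 2.
Proof.
move=> XD; rewrite rnorm_sqr inner_sumr raddf_sum /= big_seq [RHS]big_seq.
apply: eq_bigr => i iX; rewrite innerZr orthonormal_coef // mulrC mul_conj.
by rewrite of_realK.
Qed.

(** Among all combinations of the [u i] with [i] in [X], the one with Fourier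
    coefficients is nearest to [f], and the excess is explicit. *)
Lemma orthonormal_dist f X c : [set` X] `<=` D ->
  rnorm (f - \sum_(i <- X) c i *: u i) ^+ 2 =
  rnorm f ^+ 2 - \sum_(i <- X) rnorm (inner f (u i)) ^+ 2
  + \sum_(i <- X) rnorm (inner f (u i) - c i) ^+ 2.
Proof.
move=> XD; rewrite rnormB_sqr orthonormal_rnorm_sum // -!addrA; congr (_ + _).
rewrite inner_sumr raddf_sum /= mulr_sumr -!sumrN -!big_split /=.
apply: eq_bigr => i _; rewrite innerZr.
set a := inner f (u i); set b := c i.
have sq (d : F) : rnorm d ^+ 2 = sre (d * sconj d) by rewrite mul_conj of_realK.
rewrite !sq rmorphB mulrBl !mulrBr !raddfB /=.
have -> : sre (b * sconj a) = sre (sconj b * a).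
  by rewrite -sre_conj rmorphM /= sconjK.
rewrite (mulrC a (sconj b)); ring.
Qed.

Lemma orthonormal_partial f X : [set` X] `<=` D ->
  rnorm (f - \sum_(i <- X) inner f (u i) *: u i) ^+ 2 =
  rnorm f ^+ 2 - \sum_(i <- X) rnorm (inner f (u i)) ^+ 2.
Proof.
move=> XD; rewrite orthonormal_dist // -[RHS]addr0; congr (_ + _).
by apply: big1 => i _; rewrite subrr rnorm0 expr0n.
Qed.

Lemma Bessel_inequality f X : [set` X] `<=` D ->
  \sum_(i <- X) rnorm (inner f (u i)) ^+ 2 <= rnorm f ^+ 2.
Proof. by move=> /(orthonormal_partial f) h; rewrite -subr_ge0 -h sqr_ge0. Qed.

(** By the best approximation identity, approximating [f] by combinations
    forces equality in Bessel's inequality. *)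
Lemma complete_Parseval : complete_sequence D u <-> forall f,
  (\esum_(i in D) (rnorm (inner f (u i)) ^+ 2)%:E = (rnorm f ^+ 2)%:E)%E.
Proof.
split=> [/denseP h f|h].
  apply/le_anti/andP; split.
    by apply/esum_leP; [move=> i; exact: sqr_ge0|move=> X; exact: Bessel_inequality].
  apply/lee_addgt0Pr => e e0.
  have e1 : 0 < Num.sqrt e by rewrite sqrtr_gt0.
  have [_ [X [c [XD ->]]] fX] := (closureP _ _).1 (h f) _ e1.
  move: fX; rewrite -(@ltr_pXn2r R 2 isT) ?nnegrE ?rnorm_ge0 ?sqrtr_ge0 //.
  rewrite orthonormal_dist // (sqr_sqrtr (ltW e0)) => fX.
  apply: (@le_trans _ _ ((\sum_(i <- X) rnorm (inner f (u i)) ^+ 2)%:E + e%:E)%E).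
    rewrite -EFinD lee_fin.
    have : 0 <= \sum_(i <- X) rnorm (inner f (u i) - c i) ^+ 2.
      by apply: sumr_ge0 => i _; exact: sqr_ge0.
    lra.
  rewrite leeD2r // ; apply: esum_ge; exists [set` X].
    by split=> //; exact: finite_fset.
  by rewrite fsbig_finite ?finite_fset//= set_fsetK sumEFin.
apply/complete_sequenceP => f fu; apply/rnorm0_eq0/eqP.
rewrite -sqrf_eq0 -eqe -h; apply/eqP/esum1 => i /fu ->.
by rewrite rnorm0 expr0n.
Qed.

Lemma orthonormal_expansion f : complete_sequence D u ->
  has_sum D (fun i => inner f (u i) *: u i) f.
Proof.
move=> /denseP h; apply/has_sumP => e e0.
have [_ [X0 [c [X0D ->]]] f0] := (closureP _ _).1 (h f) e e0.
exists X0 => X X0X; rewrite finite_sums_filter; apply: le_lt_trans f0.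
set Y := [fset i in X | _]%fset.
have YD : [set` Y] `<=` D by exact: sub_fset_filter.
rewrite -(@ler_pXn2r R 2 isT) ?nnegrE ?rnorm_ge0 //.
rewrite orthonormal_partial // orthonormal_dist //.
have : 0 <= \sum_(i <- X0) rnorm (inner f (u i) - c i) ^+ 2.
  by apply: sumr_ge0 => i _; exact: sqr_ge0.
suff : \sum_(i <- X0) rnorm (inner f (u i)) ^+ 2 <=
  \sum_(i <- Y) rnorm (inner f (u i)) ^+ 2 by lra.
rewrite [leRHS](big_fsetID _ (mem X0)) /= (_ : [fset _ | _ in _ & _]%fset = X0).
  by rewrite lerDl sumr_ge0 // => i _; exact: sqr_ge0.
apply/fsetP => i; rewrite !inE /=; case: (boolP (i \in X0)) => [iX0|]; rewrite ?andbF ?andbT //.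
by rewrite (fsubsetP X0X) //=; apply/mem_set/X0D.
Qed.

End Orthonormal.

Section Bessel.
Context {D : set I} {u : I -> U} {B : R}.
Hypothesis B0 : 0 < B.
Hypothesis uB : forall f,
  (\esum_(i in D) (rnorm (inner f (u i)) ^+ 2)%:E <= (B * rnorm f ^+ 2)%:E)%E.

(** The synthesis operator is adjoint to the analysis operator, hence has the
    same bound.  Writing [x] for the combination, [|x|^2] is the sum of the
    [c i * <u i, x>], and each term is split by
    [2 p q <= B p^2 + q^2 / B] so that the Bessel bound at [x] absorbs half of
    the left side. *)
Lemma bessel_synthesis X c : [set` X] `<=` D ->
  rnorm (\sum_(i <- X) c i *: u i) ^+ 2 <= B * \sum_(i <- X) rnorm (c i) ^+ 2.
Proof.
move=> XD; set x := \sum_(i <- X) _.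
have hx : \sum_(i <- X) rnorm (inner x (u i)) ^+ 2 <= B * rnorm x ^+ 2.
  by apply: ((esum_leP _ _ _).1 (uB x)) => // i; exact: sqr_ge0.
suff : 2 * rnorm x ^+ 2 <= B * \sum_(i <- X) rnorm (c i) ^+ 2 +
    B^-1 * \sum_(i <- X) rnorm (inner x (u i)) ^+ 2.
  have : B^-1 * \sum_(i <- X) rnorm (inner x (u i)) ^+ 2 <= rnorm x ^+ 2.
    by rewrite ler_pdivrMl.
  lra.
rewrite {1}rnorm_sqr {1}/x inner_suml raddf_sum /= !mulr_sumr -big_split /=.
apply: ler_sum => i _; rewrite innerZl.
have h := sre_le_rnorm (c i * inner (u i) x).
rewrite rnormM (rnorm_innerC (u i)) in h.
have := rnorm_ge0 (c i); have := rnorm_ge0 (inner x (u i)).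
move: (rnorm (c i)) (rnorm (inner x (u i))) h => p q h q0 p0.
have : 0 <= B^-1 * (B * p - q) ^+ 2 by rewrite mulr_ge0 ?sqr_ge0 ?invr_ge0 ?ltW.
have -> : B^-1 * (B * p - q) ^+ 2 = B * p ^+ 2 - 2 * (p * q) + B^-1 * q ^+ 2.
  by field; rewrite gt_eqF.
lra.
Qed.

(** The tails of the coefficients are small, and the synthesis bound transfers
    this to the vectors. *)
Lemma bessel_has_sum (c : I -> F) C :
  (\esum_(i in D) (rnorm (c i) ^+ 2)%:E <= C%:E)%E ->
  exists s, has_sum D (fun i => c i *: u i) s.
Proof.
move=> cC; apply: has_sum_complete => e e0.
have e1 : 0 < e ^+ 2 / B by rewrite divr_gt0 ?exprn_gt0.
have [i|X hX] := esum_tail _ cC e1; first exact: sqr_ge0.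
exists X => Y YD XY; apply: rnorm_sqr_lt => //.
apply: le_lt_trans (bessel_synthesis _ YD) _.
by rewrite mulrC -ltr_pdivlMr //; exact: hX.
Qed.

End Bessel.

End Spans.

Section Limits.
Context {R : realType} {k : scalar_kind}.
Context {T : Type} {G : set_system T} {FG : Filter G}.

Lemma cvg_rnorm (U : hilbertType R k) (f : T -> U) (l : U) :
  f @ G --> l -> rnorm (f t) @[t --> G] --> rnorm l.
Proof.
move=> /cvg_rnormP fl; apply/cvgrPdist_lt => e /fl; apply: filterS => t.
apply: le_lt_trans; rewrite ler_norml; apply/andP; split.
  by rewrite lerNl opprB lerBlDr -[X in rnorm X <= _](subrK l) rnormBC rnormD.
by rewrite lerBlDr -[X in rnorm X <= _](subrK (f t)) rnormD.
Qed.

Lemma cvg_adjoint (U V : hilbertType R k) (A : {linear U -> V}) (f : T -> V) (l : V) :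
  bounded_operator A -> f @ G --> l -> adjoint A (f t) @[t --> G] --> adjoint A l.
Proof.
move=> Ab; have [M M0 AM] := adjoint_bounded Ab.
move=> /cvg_rnormP fl; apply/cvg_rnormP => e e0.
apply: filterS (fl _ (divr_gt0 e0 M0)) => t.
by rewrite ltr_pdivlMr // mulrC -adjointB //; apply: le_lt_trans.
Qed.

Lemma cvg_sum_seq (K : numFieldType) (W : normedModType K) (I : eqType) (r : seq I)
    (f : I -> T -> W) (l : I -> W) :
  (forall i, i \in r -> f i @ G --> l i) ->
  \sum_(i <- r) f i t @[t --> G] --> \sum_(i <- r) l i.
Proof.
elim: r => [|i r IHr] h.
  by rewrite big_nil; under eq_fun do rewrite big_nil; exact: cvg_cst.
rewrite big_cons; under eq_fun do rewrite big_cons.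
apply: cvgD; first by apply: h; rewrite mem_head.
by apply: IHr => j jr; apply: h; rewrite in_cons jr orbT.
Qed.

End Limits.

Lemma le_cvg_to {R : realType} {T : Type} {G : set_system T} {FG : ProperFilter G}
    (f g : T -> R) (l l' : R) :
  f @ G --> l -> g @ G --> l' -> (forall t, f t <= g t) -> l <= l'.
Proof.
move=> fl gl fg; rewrite leNgt -subr_lt0; apply/negP => ll'.
have [t] := filter_ex (cvgr_lt _ (cvgB gl fl) _ ll').
by rewrite ltNge subr_ge0 fg.
Qed.

(** * The induced sequence: bounds, bases and completeness *)

Section Induced.
Context {R : realType} {k : scalar_kind} {U : hilbertType R k}.
Context {J : set int} {V : int -> hilbertType R k} {K : int -> set int}.
Context {e : forall j, int -> V j}.
Hypothesis he : forall j, J j -> orthonormal_basis (K j) (e j).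
Local Notation F := (scalar_field R k).
Local Notation JK := (J `*`` K).

Section OneFamily.
Context {L : forall j, {linear U -> V j}}.
Hypothesis hL : forall j, J j -> bounded_operator (L j).
Local Notation u := (induced_sequence L e).

Lemma induced_inner j i f : J j -> inner f (u (j, i)) = inner (L j f) (e j i).
Proof. by move=> Jj; rewrite adjointP //; exact: hL. Qed.

(** Parseval's identity in each [V j], followed by Tonelli's theorem. *)
Lemma induced_esum f :
  (\esum_(j in J) (rnorm (L j f) ^+ 2)%:E =
   \esum_(p in JK) (rnorm (inner f (u p)) ^+ 2)%:E)%E.
Proof.
have sq0 p : (0 <= (rnorm (inner f (u p)) ^+ 2)%:E)%E by rewrite lee_fin sqr_ge0.
rewrite (eq_esum (b := fun p => (rnorm (inner f (u (p.1, p.2))) ^+ 2)%:E)); last first.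
  by move=> [].
rewrite -(esum_esum (a := fun j i => (rnorm (inner f (u (j, i))) ^+ 2)%:E)) //.
apply: eq_esum => j Jj; have [eo ec] := he Jj.
rewrite -((complete_Parseval eo).1 ec); apply: eq_esum => i Ki.
by rewrite induced_inner.
Qed.

Lemma induced_gframe_bounds A B :
  gframe_bounds J L A B <-> frame_bounds JK u A B.
Proof. by split=> h f; have := h f; rewrite induced_esum. Qed.

Lemma induced_gframe : gframe J L <-> frame JK u.
Proof.
by split=> -[A [B [A0 B0 h]]]; exists A, B; split=> //; exact/induced_gframe_bounds.
Qed.

Lemma induced_tight : tight_gframe J L <-> tight_frame JK u.
Proof. by split=> -[A A0 h]; exists A => //; exact/induced_gframe_bounds. Qed.

Lemma induced_bessel : gbessel_sequence J L <-> bessel_sequence JK u.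
Proof. by split=> -[B B0 h]; exists B => // f; have := h f; rewrite induced_esum. Qed.

Lemma gframe_bessel : gframe J L -> bessel_sequence JK u.
Proof. by move=> /induced_gframe[A [B [_ B0 h]]]; exists B => // f; case: (h f). Qed.

Lemma frame_complete {I : choiceType} (D : set I) (w : I -> U) : frame D w -> complete_sequence D w.
Proof.
move=> [A [B [A0 _ h]]]; apply/complete_sequenceP => f fw.
apply/rnorm0_eq0/eqP; rewrite -sqrf_eq0 eq_le sqr_ge0 andbT -(ler_pM2l A0) mulr0.
rewrite -lee_fin; have [/le_trans + _] := h f; apply.
by rewrite esum1 // => p /fw ->; rewrite rnorm0 expr0n.
Qed.

Lemma induced_zero f :
  (forall j, J j -> L j f = 0) <-> (forall p, JK p -> inner f (u p) = 0).
Proof.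
split=> [h [j i] [/= Jj Ki]|h j Jj]; first by rewrite induced_inner // h // inner0l.
have [_ /complete_sequenceP] := he Jj; apply => i Ki.
by rewrite -induced_inner // h.
Qed.

Lemma induced_complete : gcomplete J L <-> complete_sequence JK u.
Proof.
rewrite complete_sequenceP /gcomplete; split=> [h f /induced_zero|h].
  by move=> fL; have : [set 0] f by rewrite -h.
apply/seteqP; split=> f /=; first by move/induced_zero/h.
by move=> -> j _; rewrite linear0.
Qed.

Lemma adjoint_expansion j g : J j ->
  has_sum (K j) (fun i => inner g (e j i) *: u (j, i)) (adjoint (L j) g).
Proof.
move=> Jj; have Lb := hL Jj; have [eo ec] := he Jj.
rewrite /has_sum.
rewrite (_ : finite_sums _ _ =
  fun X => adjoint (L j) (finite_sums (K j) (fun i => inner g (e j i) *: e j i) X)).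
  exact/cvg_adjoint/orthonormal_expansion.
apply/funext => X; rewrite adjoint_sum //; apply: eq_bigr => i _.
by rewrite adjointZ.
Qed.

(** In the backward direction, [LLe] and [Lu] compute
    [L j' (u (j, i))]; they yield [L j (L j)^* = 1] and [L j' (L j)^* = 0],
    from which the two orthogonality relations are read off. *)
Lemma induced_orthonormal : gorthonormal_basis J L <-> orthonormal_basis JK u.
Proof.
split=> [[h1 h2 h3]|[uo uc]].
  have uo : orthonormal_sequence JK u.
    move=> [j i] [j' i'] [/= Jj Ki] [/= Jj' Ki'].
    have [jj'|jj'] := eqVneq j j'; last first.
      by rewrite /induced_sequence /= h2 //= xpair_eqE (negPf jj').
    case: _ / jj' Jj' Ki' => _ Ki'.
    by rewrite /induced_sequence /= h1 // xpair_eqE eqxx (he Jj).1.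
  split=> //; apply/(complete_Parseval uo) => f.
  by rewrite -induced_esum h3.
have Lu j i j' : J j -> J j' -> K j i -> j != j' -> L j' (u (j, i)) = 0.
  move=> Jj Jj' Ki jj'; have [_ /complete_sequenceP] := he Jj'; apply => i' Ki'.
  by rewrite -induced_inner // uo // xpair_eqE (negPf jj').
have LLe j i : J j -> K j i -> L j (u (j, i)) = e j i.
  move=> Jj Ki; have [eo ec] := he Jj; apply: (eq_complete ec) => i' Ki'.
  by rewrite -induced_inner // uo // eo // xpair_eqE eqxx.
have LL j g : J j -> L j (adjoint (L j) g) = g.
  move=> Jj; have [eo ec] := he Jj; apply: (eq_complete ec) => i Ki.
  rewrite -induced_inner // innerC adjointP; last exact: hL.
  by rewrite LLe // -innerC.
split.
- by move=> j Jj g g'; rewrite adjointP ?LL //; exact: hL.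
- move=> j j' Jj Jj' jj' g g'; rewrite adjointP; last exact: hL.
  rewrite (_ : L j' _ = 0) ?inner0l //.
  have [_ /complete_sequenceP] := he Jj'; apply => i Ki.
  rewrite -induced_inner // innerC adjointP; last exact: hL.
  by rewrite Lu // 1?eq_sym // inner0l rmorph0.
- by move=> f; rewrite induced_esum; exact: (complete_Parseval uo).1.
Qed.

(** Coefficients [c] on pairs are collected into the vectors
    [g j = sum_i c (j, i) e j i]; orthonormality gives
    [|g j|^2 = sum_i |c (j, i)|^2]. *)
Lemma induced_riesz_basis : griesz_basis J L -> riesz_basis JK u.
Proof.
move=> [/induced_complete uc [A [B [A0 B0 h]]]]; split=> //.
exists A, B; split=> // X c XJK.
pose g j := \sum_(p <- X | p.1 == j) c p *: e j p.2.
pose Y := [fset p.1 | p in X]%fset.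
have YJ : [set` Y] `<=` J by move=> _ /imfsetP[p /= /XJK[Jp _] ->].
have -> : \sum_(p <- X) rnorm (c p) ^+ 2 = \sum_(j <- Y) rnorm (g j) ^+ 2.
  rewrite (partition_big_imfset _ (fun p => p.1)) /= big_seq [RHS]big_seq.
  apply: eq_bigr => j jY; have [eo _] := he (YJ _ jY).
  (* The pairs with first index [j] are themselves used as indices of
     [e j], which avoids reindexing the sum by second indices. *)
  have Eo : orthonormal_sequence [set p : int * int | p.1 = j /\ K j p.2] (fun p => e j p.2).
    move=> [j1 i1] [j2 i2] [/= -> K1] [/= -> K2].
    by rewrite eo // xpair_eqE eqxx.
  have XE : [set` [fset p in X | p.1 == j]%fset] `<=` [set p | p.1 = j /\ K j p.2].
    by move=> p /=; rewrite !inE /= => /andP[/XJK[_ Kp] /eqP pj]; rewrite -pj.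
  have := orthonormal_rnorm_sum Eo c XE; rewrite !big_fset => <-.
  by [].
have -> : \sum_(p <- X) c p *: u p = \sum_(j <- Y) adjoint (L j) (g j).
  rewrite (partition_big_imfset _ (fun p => p.1)) /= big_seq [RHS]big_seq.
  apply: eq_bigr => j jY; have Lb := hL (YJ _ jY).
  rewrite adjoint_sum //; apply: eq_bigr => -[j' i] /= /eqP ->.
  by rewrite adjointZ.
exact: h.
Qed.

(** Cutting all the expansions of the [g j] at the same finite set [X] of
    second indices gives finite combinations of the [u p], whose coefficients
    do not depend on [X]; the inequalities pass to the limit along [X]. *)
Lemma riesz_basis_induced : riesz_basis JK u -> griesz_basis J L.
Proof.
move=> [/induced_complete uc [A [B [A0 B0 h]]]]; split=> //.
exists A, B; split=> // Y g YJ.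
pose c (p : int * int) : F := inner (g p.1) (e p.1 p.2).
pose H (X : {fset int}) j := finite_sums (K j) (fun i => c (j, i) *: e j i) X.
have Hg j : j \in Y -> H^~ j @ totally --> g j.
  by move=> /YJ/he[eo ec]; exact: orthonormal_expansion.
pose Z (X : {fset int}) :=
  [fset ((j, i) : int * int) | j in Y, i in [fset i in X | i \in K j]%fset]%fset.
have ZJK X : [set` Z X] `<=` JK.
  move=> _ /imfset2P[j /= jY [i /= + ->]]; rewrite !inE /= => /andP[_ /set_mem Ki].
  by split=> //; exact: YJ.
have sumZ (W : nmodType) (f : int * int -> W) X : \sum_(p <- Z X) f p =
    \sum_(j <- Y) \sum_(i <- X | i \in K j) f (j, i).
  rewrite /Z big_imfset2 /=; last by move=> [? ?] [? ?] _ _ /= [-> ->].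
  by apply: eq_bigr => j _; rewrite big_fset.
have hH X : A * \sum_(j <- Y) rnorm (H X j) ^+ 2
        <= rnorm (\sum_(j <- Y) adjoint (L j) (H X j)) ^+ 2 /\
      rnorm (\sum_(j <- Y) adjoint (L j) (H X j)) ^+ 2
        <= B * \sum_(j <- Y) rnorm (H X j) ^+ 2.
  have -> : \sum_(j <- Y) adjoint (L j) (H X j) = \sum_(p <- Z X) c p *: u p.
    rewrite sumZ big_seq [RHS]big_seq; apply: eq_bigr => j /YJ/hL Lb.
    by rewrite adjoint_sum //; apply: eq_bigr => i _; rewrite adjointZ.
  have -> : \sum_(j <- Y) rnorm (H X j) ^+ 2 = \sum_(p <- Z X) rnorm (c p) ^+ 2.
    rewrite sumZ big_seq [RHS]big_seq; apply: eq_bigr => j /YJ/he[eo _].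
    rewrite /H finite_sums_filter (orthonormal_rnorm_sum eo) ?big_fset //.
    exact: sub_fset_filter.
  exact: h.
have c1 : \sum_(j <- Y) rnorm (H X j) ^+ 2 @[X --> totally] -->
    \sum_(j <- Y) rnorm (g j) ^+ 2.
  apply: cvg_sum_seq => j jY; rewrite expr2; apply: cvgM; exact/cvg_rnorm/Hg.
have c2 : rnorm (\sum_(j <- Y) adjoint (L j) (H X j)) ^+ 2 @[X --> totally] -->
    rnorm (\sum_(j <- Y) adjoint (L j) (g j)) ^+ 2.
  rewrite expr2; apply: cvgM; apply: cvg_rnorm; apply: cvg_sum_seq => j jY;
    apply: cvg_adjoint; [exact/hL/YJ|exact: Hg|exact/hL/YJ|exact: Hg].
split; [apply: (le_cvg_to (cvgMl_tmp c1) c2)|apply: (le_cvg_to c2 (cvgMl_tmp c1))];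
  by move=> X; case: (hH X).
Qed.

End OneFamily.

End Induced.

(** * Frame operators and duality *)

(** Both [<S f, g>] and [<f, S g>] are limits of the same finite sums of
    [<f, u i> <u i, g>]. *)
Lemma frame_sum_selfadjoint {R : realType} {k : scalar_kind} {U : hilbertType R k}
    {I : choiceType} (D : set I) (u : I -> U) (S : U -> U) :
  (forall f, has_sum D (fun i => inner f (u i) *: u i) (S f)) ->
  forall f g, inner (S f) g = inner f (S g).
Proof.
move=> hS f g; apply/eqP; rewrite -subr_eq0; apply/eqP.
apply: rnorm_le_eq0 => d d0.
pose C := rnorm f + rnorm g + 1.
have C0 : 0 < C by have := rnorm_ge0 f; have := rnorm_ge0 g; rewrite /C; lra.
have dC : 0 < d / C by rewrite divr_gt0.
have /has_sumP/(_ _ dC)[X hX] := hS f; have /has_sumP/(_ _ dC)[Y hY] := hS g.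
have {hX} := hX (X `|` Y)%fset (fsubsetUl _ _).
have {hY} := hY (X `|` Y)%fset (fsubsetUr _ _).
set a := finite_sums _ _ _; set b := finite_sums _ _ _ => hg hf.
have ab : inner b g = inner f a.
  rewrite inner_suml inner_sumr; apply: eq_bigr => i _.
  by rewrite innerZl innerZr -innerC mulrC.
rewrite (_ : _ - _ = inner (S f - b) g - inner f (S g - a)); last first.
  by rewrite innerBl innerBr ab opprB addrA subrK.
apply: le_trans (rnormB _ _) _.
have h1 := Cauchy_Schwarz (S f - b) g; have h2 := Cauchy_Schwarz f (S g - a).
have h3 : rnorm (S f - b) * rnorm g <= d / C * rnorm g.
  by rewrite ler_wpM2r ?rnorm_ge0 // ltW.
have h4 : rnorm f * rnorm (S g - a) <= rnorm f * (d / C).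
  by rewrite ler_wpM2l ?rnorm_ge0 // ltW.
have h5 : d / C * C = d by rewrite divfK // gt_eqF.
rewrite /C in h5 *; rewrite /C in h3 h4; nra.
Qed.

Section InducedDuality.
Context {R : realType} {k : scalar_kind} {U : hilbertType R k}.
Context {J : set int} {V : int -> hilbertType R k} {K : int -> set int}.
Context {e : forall j, int -> V j}.
Hypothesis he : forall j, J j -> orthonormal_basis (K j) (e j).
Local Notation JK := (J `*`` K).
Implicit Types L M : forall j, {linear U -> V j}.

(** The sum over pairs exists because the coefficients [<f, u p>] are
    square-summable and the [M]-side is Bessel; its fibre sums are the
    expansions of [(M j)^* (L j f)]. *)
Lemma induced_has_sum L M f :
  (forall j, J j -> bounded_operator (L j)) ->
  (forall j, J j -> bounded_operator (M j)) ->
  gframe J L -> gframe J M ->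
  exists s, has_sum JK (fun p => inner f (induced_sequence L e p) *: induced_sequence M e p) s /\
    has_sum J (fun j => adjoint (M j) (L j f)) s.
Proof.
move=> hL hM /(gframe_bessel he hL)[B B0 uB] /(gframe_bessel he hM)[C C0 vC].
have [s hs] := bessel_has_sum C0 vC (uB f); exists s; split=> //.
apply: has_sum_sigma hs _ => j Jj.
have := @adjoint_expansion _ _ _ _ _ _ _ he _ hM _ (L j f) Jj; apply: eq_has_sum => i Ki.
by rewrite (induced_inner hL).
Qed.

Lemma induced_has_sumP L M f s :
  (forall j, J j -> bounded_operator (L j)) ->
  (forall j, J j -> bounded_operator (M j)) ->
  gframe J L -> gframe J M ->
  has_sum J (fun j => adjoint (M j) (L j f)) s <->
  has_sum JK (fun p => inner f (induced_sequence L e p) *: induced_sequence M e p) s.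
Proof.
move=> hL hM gL gM; have [t [h1 h2]] := induced_has_sum f hL hM gL gM.
by split=> h; [rewrite (has_sum_unique h h2)|rewrite (has_sum_unique h h1)].
Qed.

Lemma induced_dual L M :
  (forall j, J j -> bounded_operator (L j)) ->
  (forall j, J j -> bounded_operator (M j)) ->
  dual_gframes J L M <->
  dual_frames JK (induced_sequence L e) (induced_sequence M e).
Proof.
move=> hL hM; split=> -[gL gM h1 h2].
  split; [exact/(induced_gframe he hL)|exact/(induced_gframe he hM)| |];
  by move=> f; apply/induced_has_sumP.
have {}gL : gframe J L by exact/(induced_gframe he hL).
have {}gM : gframe J M by exact/(induced_gframe he hM).
by split=> // f; apply/induced_has_sumP.
Qed.

Lemma induced_frame_operator L : (forall j, J j -> bounded_operator (L j)) ->
  gframe J L ->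
  [/\ forall f, has_sum J (fun j => adjoint (L j) (L j f)) (gframe_operator J L f),
      forall f, has_sum JK
        (fun p => inner f (induced_sequence L e p) *: induced_sequence L e p)
        (frame_operator JK (induced_sequence L e) f) &
      gframe_operator J L =1 frame_operator JK (induced_sequence L e)].
Proof.
move=> hL gL; have h f := induced_has_sum f hL hL gL gL.
by split=> f; have [s [h1 h2]] := h f;
  rewrite /gframe_operator /frame_operator ?(usum_eq h1) ?(usum_eq h2).
Qed.

(** The inverse [T] of the frame operator is symmetric, so taking adjoints of
    [M j = L j T] gives [(M j)^* = T (L j)^*], which is tested on the [e j i]. *)
Lemma induced_canonical_dual L M :
  (forall j, J j -> bounded_operator (L j)) ->
  (forall j, J j -> bounded_operator (M j)) ->
  canonical_dual_gframes J L M <->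
  canonical_dual_frames JK (induced_sequence L e) (induced_sequence M e).
Proof.
move=> hL hM.
suff TP (T : U -> U) : gframe J L -> cancel T (frame_operator JK (induced_sequence L e)) ->
   (forall j, J j -> forall f, M j f = L j (T f)) <->
   (forall p, JK p -> induced_sequence M e p = T (induced_sequence L e p)).
  split=> -[gL gM [T [ST TS MT]]].
    have [_ _ /funext SS] := induced_frame_operator hL gL; rewrite SS in ST TS.
    split; [exact/(induced_gframe he hL)|exact/(induced_gframe he hM)|].
    by exists T; split=> //; apply/TP.
  have {}gL : gframe J L by exact/(induced_gframe he hL).
  have {}gM : gframe J M by exact/(induced_gframe he hM).
  have [_ _ /funext SS] := induced_frame_operator hL gL.
  by split=> //; exists T; rewrite SS; split=> //; apply/TP.
move=> gL TS; have [_ /frame_sum_selfadjoint Sa _] := induced_frame_operator hL gL.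
have Ta f g : inner (T f) g = inner f (T g) by rewrite -{1}(TS g) -Sa TS.
split=> [MT [j i] [/= Jj Ki]|MT j Jj f].
  apply: eq_inner => f; rewrite -Ta (induced_inner hM) // (induced_inner hL) //.
  by rewrite MT.
have [eo ec] := he Jj; apply: (eq_complete ec) => i Ki.
by rewrite -(induced_inner hM) // -(induced_inner hL) // MT // Ta.
Qed.

End InducedDuality.

(** * Hilbert dimension *)

Section Dimension.
Context {R : realType} {k : scalar_kind} {U : hilbertType R k}.
Local Notation F := (scalar_field R k).

Definition independent {I : choiceType} (D : set I) (x : I -> U) :=
  forall (X : {fset I}) (c : I -> F), [set` X] `<=` D ->
    \sum_(i <- X) c i *: x i = 0 -> forall i, i \in X -> c i = 0.

Lemma orthonormal_independent {I : choiceType} (D : set I) (x : I -> U) :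
  orthonormal_sequence D x -> independent D x.
Proof.
move=> xo X c XD c0 i iX.
by rewrite -(orthonormal_coef xo c XD iX) c0 inner0l.
Qed.

Lemma riesz_independent {I : choiceType} (D : set I) (x : I -> U) :
  riesz_basis D x -> independent D x.
Proof.
move=> [_ [A [B [A0 B0 h]]]] X c XD c0 i iX.
have [+ _] := h X c XD; rewrite c0 rnorm0 expr0n /= pmulr_rle0 // => h0.
have s0 : \sum_(i <- X) rnorm (c i) ^+ 2 == 0.
  by rewrite eq_le h0 sumr_ge0 // => j _; exact: sqr_ge0.
move: s0; rewrite psumr_eq0; last by move=> j _; exact: sqr_ge0.
by move=> /allP/(_ i iX) /=; rewrite sqrf_eq0 => /eqP/rnorm0_eq0.
Qed.

(** With more [x]'s than [w]'s, the matrix of the inner products [<x i, w j>]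
    has a nontrivial left kernel, that is, some nontrivial combination of the
    [x i] is orthogonal to every [w j]. *)
Lemma independent_card {I I' : choiceType} (w : I -> U) (x : I' -> U)
    (E : set I') (X : {fset I'}) (Y : {fset I}) :
  complete_sequence [set` Y] w -> independent E x -> [set` X] `<=` E ->
  (#|` X| <= #|` Y|)%N.
Proof.
move=> /complete_sequenceP wc xi XE; rewrite leqNgt; apply/negP => YX.
pose A : 'M[F]_(#|` X|, #|` Y|) := \matrix_(i, j)
  inner (x (tnth (in_tuple (enum_fset X)) i)) (w (tnth (in_tuple (enum_fset Y)) j)).
have : kermx A != 0.
  rewrite -mxrank_eq0 mxrank_ker -lt0n subn_gt0.
  by apply: leq_ltn_trans YX; exact: rank_leq_col.
move=> /rowV0Pn[c /sub_kermxP cA] /negP; apply; apply/eqP/rowP => i; rewrite mxE.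
pose c' (a : I') : F := if insub (index a X) is Some i then c 0 i else 0.
have c'E j : c' (tnth (in_tuple (enum_fset X)) j) = c 0 j.
  rewrite /c' (tnth_nth (tnth (in_tuple (enum_fset X)) i)) /= index_uniq ?fset_uniq //.
  by rewrite valK.
rewrite -c'E; apply: (xi X) => //; last exact: mem_tnth.
apply: wc => a aY.
rewrite inner_suml big_tnth.
have /(nthP a)[n nY an] := aY.
have := congr1 (fun M : 'rV_ _ => M 0 (Ordinal nY)) cA; rewrite !mxE => {2}<-.
apply: eq_bigr => j _; rewrite innerZl c'E mxE; congr (_ * inner _ (w _)).
by rewrite (tnth_nth a) /= an.
Qed.

(** If [D] is infinite the countability of [E] suffices; otherwise this is the
    bound of [independent_card] on the finite subsets of [E]. *)
Lemma complete_card_le {I I' : choiceType} (w : I -> U) (x : I' -> U)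
    (D : set I) (E : set I') :
  complete_sequence D w -> independent E x -> countable E -> (E #<= D)%card.
Proof.
move=> wc xi Ec; have [Df|/infiniteP] := pselect (finite_set D); last first.
  exact: card_le_trans.
have [Y DY] := finite_fsetP.1 Df; rewrite DY in wc *.
have XY (X : {fset I'}) : [set` X] `<=` E -> (#|` X| <= #|` Y|)%N.
  exact: independent_card wc xi.
have Ef : finite_set E.
  apply: contrapT => /(@infinite_set_fset _ _ #|` Y|.+1)[X XE].
  by rewrite ltnNge XY.
have [X EX] := finite_fsetP.1 Ef; rewrite EX in XY *.
have [n Xn] := finite_fset X; have [m Ym] := finite_fset Y.
rewrite (card_le_eql Xn) (card_le_eqr Ym) card_le_II.
rewrite -(card_fset_set Xn) -(card_fset_set Ym) !set_fsetK.
exact: XY.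
Qed.

(** By Bessel's inequality, for each [w i] and [n] only finitely many [x b]
    satisfy [|<w i, x b>|^2 > 1 / (n + 1)]; an [x b] outside all these sets
    would be orthogonal to every [w i]. *)
Lemma orthonormal_countable {I I' : choiceType} (w : I -> U) (x : I' -> U)
    (D : set I) (E : set I') :
  complete_sequence D w -> countable D -> orthonormal_sequence E x -> countable E.
Proof.
move=> /complete_sequenceP wc Dc xo.
pose S (i : I) (n : nat) :=
  E `&` [set b | n.+1%:R^-1 < rnorm (inner (w i) (x b)) ^+ 2].
have Sf i n : finite_set (S i n).
  apply: contrapT; pose N := (Num.truncn (n.+1%:R * rnorm (w i) ^+ 2)).+1.
  move=> /(@infinite_set_fset _ _ N)[B BS NB].
  have BE : [set` B] `<=` E by move=> b /BS[].
  have := Bessel_inequality xo (w i) BE.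
  apply/negP; rewrite -ltNge.
  apply: (@lt_le_trans _ _ (\sum_(b <- B) n.+1%:R^-1)); last first.
    by rewrite big_seq [leRHS]big_seq; apply: ler_sum => b /BS[_ /ltW].
  rewrite big_const_seq count_predT iter_addr_0 -[_ *+ size B]mulr_natr mulrC.
  rewrite ltr_pdivlMr ?ltr0n // mulrC.
  apply: (@lt_le_trans _ _ N%:R); first exact: Num.Theory.truncnS_gt.
  by rewrite ler_nat.
apply: (@sub_countable _ _ _ (\bigcup_(i in D) \bigcup_n S i n)); last first.
  apply: bigcup_countable => // i _; apply: bigcup_countable => // n _.
  exact: finite_set_countable.
apply: subset_card_le => b Eb; apply: contrapT => bS.
have xb0 : x b = 0.
  apply: wc => i Di; apply/rnorm0_eq0/eqP; rewrite rnorm_innerC -sqrf_eq0.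
  apply: contrapT => /negP n0.
  have n1 : 0 < rnorm (inner (w i) (x b)) ^+ 2 by rewrite lt_def n0 sqr_ge0.
  apply: bS; exists i => //; exists (Num.truncn (rnorm (inner (w i) (x b)) ^+ 2)^-1) => //.
  split=> //=; rewrite invf_plt ?posrE ?ltr0n //; exact: Num.Theory.truncnS_gt.
have := xo b b Eb Eb; rewrite xb0 inner0l eqxx => /esym/eqP.
by rewrite oner_eq0.
Qed.

(** A maximal orthonormal set is complete: a unit vector orthogonal to it could
    be added. *)
Lemma orthonormal_basis_exists : exists B : set U, orthonormal_basis B id.
Proof.
have [|B [Bo Bmax]] := @Zorn_bigcup U [set B : set U | orthonormal_sequence B id].
  move=> G GP Gt x y [A GA Ax] [B GB By].
  have [AB|BA] := Gt _ _ GA GB.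
    by apply: (GP B GB) => //; exact: AB.
  by apply: (GP A GA) => //; exact: BA.
exists B; split=> //; apply/complete_sequenceP => f fB; apply: contrapT => f0.
have n0 : rnorm f != 0 by apply/eqP => /rnorm0_eq0.
pose g := of_real (rnorm f)^-1 *: f.
have gg : inner g g = 1.
  by rewrite inner_self rnormZ rnorm_of_real ?invr_ge0 ?rnorm_ge0 // mulVf // expr1n rmorph1.
have gB b : B b -> inner g b = 0 by move=> Bb; rewrite innerZl fB // mulr0.
have Bg b : B b -> inner b g = 0 by move=> Bb; rewrite innerC gB // rmorph0.
have ng : ~ B g by move=> /gB; rewrite gg => /eqP; rewrite oner_eq0.
have Bneq b : B b -> (b == g) = false by move=> Bb; apply/eqP => bg; rewrite -bg in ng.
apply: (Bmax (B `|` [set g])).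
  by split; [exact: subsetUl|move=> /(_ g) h; apply/ng/h; right].
move=> x y [Bx|->] [By|->].
- exact: Bo.
- by rewrite Bg // Bneq.
- by rewrite gB // eq_sym Bneq.
- by rewrite gg eqxx.
Qed.

Lemma hilbert_basisP : orthonormal_basis (hilbert_basis U) id.
Proof. exact: (xgetPex set0 orthonormal_basis_exists). Qed.

Lemma hilbert_basis_card {I : countType} (D : set I) (w : I -> U) :
  orthonormal_basis D w -> (hilbert_basis U #= D)%card.
Proof.
move=> [wo wc]; have [bo bc] := hilbert_basisP.
apply: Cantor_Bernstein.
  apply: (complete_card_le wc (orthonormal_independent bo)).
  exact: (orthonormal_countable wc (countableP D) bo).
exact: (complete_card_le bc (orthonormal_independent wo) (countableP D)).
Qed.

End Dimension.

(** The chosen orthonormal basis of [V j] is in bijection with [K j], as any two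
    orthonormal bases of a separable space are; these bijections are glued over
    [j]. *)
Lemma hilbert_bases_card {R : realType} {k : scalar_kind} (J : set int)
    (V : int -> hilbertType R k) (K : int -> set int) (e : forall j, int -> V j) :
  (forall j, J j -> orthonormal_basis (K j) (e j)) ->
  (hilbert_bases J V #= J `*`` K)%card.
Proof.
move=> he.
have bij j : exists f : int -> V j, J j -> set_bij (K j) (hilbert_basis (V j)) f.
  have [Jj|nJ] := pselect (J j); last by exists (fun=> 0).
  by have /card_esym/card_set_bijP[f hf] := hilbert_basis_card (he j Jj); exists f.
pose f j := projT1 (cid (bij j)); have hf j := projT2 (cid (bij j)).
pose g (p : int * int) : {j & V j} := existT _ p.1 (f p.1 p.2).
have -> : hilbert_bases J V = g @` (J `*`` K).
  apply/seteqP; split=> [[j x] [/= Jj xB]|_ [[j i] [/= Jj Ki] <-]].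
    by have [_ _ h] := hf j Jj; have [i Ki <-] := h x xB; exists (j, i).
  by split=> //=; have [h _ _] := hf j Jj; exact: h.
apply: inj_card_eq => -[j i] [j' i'] /set_mem[/= Jj Ki] /set_mem[/= Jj' Ki'].
move=> gg; have jj' : j = j' := congr1 (@projT1 _ _) gg.
case: _ / jj' Jj' Ki' gg => _ Ki'.
have [_ h _] := hf j Jj => /eqP; rewrite eq_Tagged /= => /eqP fi.
by rewrite (h i i') ?inE.
Qed.

Theorem theorem3p1 (R : realType) (k : scalar_kind) (U : hilbertType R k)
    (J : set int) (V : int -> hilbertType R k) (K : int -> set int)
    (e : forall j, int -> V j)
    (he : forall j, J j -> orthonormal_basis (K j) (e j))
    (L : forall j, {linear U -> V j})
    (hL : forall j, J j -> bounded_operator (L j)) :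
  let JK := J `*`` K in
  let u := induced_sequence L e in
  (* (1) *)
  [/\ gframe J L <-> frame JK u,
      gbessel_sequence J L <-> bessel_sequence JK u,
      tight_gframe J L <-> tight_frame JK u,
      griesz_basis J L <-> riesz_basis JK u &
      gorthonormal_basis J L <-> orthonormal_basis JK u]
  /\
  (* (2) *)
  (gframe J L ->
    (hilbert_basis U #<= hilbert_bases J V)%card /\
    (griesz_basis J L -> (hilbert_basis U #= hilbert_bases J V)%card))
  /\
  (* (3), including the convergence of the two series *)
  (gframe J L ->
    [/\ forall f, has_sum J (fun j => adjoint (L j) (L j f))
                    (gframe_operator J L f),
        forall f, has_sum JK (fun p => inner f (u p) *: u p)
                    (frame_operator JK u f) &
        gframe_operator J L =1 frame_operator JK u])
  /\
  (* (4) *)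
  (forall M : forall j, {linear U -> V j},
    (forall j, J j -> bounded_operator (M j)) ->
    let v := induced_sequence M e in
    (dual_gframes J L M <-> dual_frames JK u v) /\
    (canonical_dual_gframes J L M <-> canonical_dual_frames JK u v)).
Proof.
move=> JK u; split.
  split.
  - exact: (induced_gframe he hL).
  - exact: (induced_bessel he hL).
  - exact: (induced_tight he hL).
  - by split; [exact: (induced_riesz_basis he hL)|exact: (riesz_basis_induced he hL)].
  - exact: (induced_orthonormal he hL).
split.
  move=> gL; have uc : complete_sequence JK u.
    exact: frame_complete ((induced_gframe he hL).1 gL).
  have [bo bc] := @hilbert_basisP R k U.
  have le1 : (hilbert_basis U #<= JK)%card.
    apply: (complete_card_le uc (orthonormal_independent bo)).
    exact: (orthonormal_countable uc (countableP JK) bo).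
  have JKV := hilbert_bases_card he.
  rewrite (card_le_eqr JKV) (card_eqr JKV); split=> // /(induced_riesz_basis he hL) rL.
  apply: Cantor_Bernstein => //.
  exact: (complete_card_le bc (riesz_independent rL) (countableP JK)).
split; first exact: (induced_frame_operator he hL).
move=> M hM v; split; first exact: (induced_dual he hL hM).
exact: (induced_canonical_dual he hL hM).
Qed.
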